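(* For all integers $s\geq 1$, $$\widehat{\alpha}(s) \geq \frac{\alpha(s) + 1}{2},$$ where $\alpha(s)$ and $\widehat{\alpha}(s)$ denote respectively the initial degree and the Waldschmidt constant of the ideal of $s$ very general lines in $\mathbb{P}^3$.
   Context: Let $\mathbb{K}$ be an uncountable algebraically closed field of characteristic $0$ and $R=\mathbb{K}[x_0,\dots,x_3]$. For a homogeneous ideal $I\subset R$, the $m$-th symbolic power is $I^{(m)}=R\cap\bigcap_{P\in\mathrm{Ass}(I)}I^mR_P$ (intersection taken in the fraction field of $R$). The initial degree of a nonzero homogeneous ideal $I$ is $\alpha(I)=\min\{t: (I)_t\neq 0\}$, where $(I)_t$ is the degree $t$ part of $I$. The Waldschmidt constant of $I$ is $\widehat{\alpha}(I)=\lim_{m\to\infty}\alpha(I^{(m)})/m$ (the limit exists). ''Very general'' means: outside a countable union of proper Zariski closed subsets of the parameter space (here the product of $s$ copies of the Grassmannian of lines in $\mathbb{P}^3$). For an integer $s\ge 1$, $\alpha(s)$ and $\widehat{\alpha}(s)$ denote the initial degree and the Waldschmidt constant of the radical ideal of the union of $s$ very general lines in $\mathbb{P}^3$. *)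

(* Defs.v *)
(* The notations of [normedtype] clash with those of [mpoly], hence the import of
   the low-level topology files only. *)
From mathcomp Require Import all_boot all_order all_algebra.
From mathcomp Require Import fraction ring_quotient.
From mathcomp Require Import boolp classical_sets cardinality reals filter.
From mathcomp Require Import topology_structure pseudometric_structure.
From mathcomp Require Import num_topology.
From mathcomp Require Import mpoly.

Set Implicit Arguments.
Unset Strict Implicit.
Unset Printing Implicit Defensive.

Import Order.TTheory GRing.Theory Num.Theory.
Import numFieldTopology.Exports.

Local Open Scope classical_set_scope.
Local Open Scope ring_scope.

Section SymbolicPowers.
Variable A : idomainType.
Implicit Types (I J P : set A) (m : nat).

(* In MathComp, [idealr_closed] includes properness ([1] is excluded). *)
Definition prime_ideal P : Prop :=
  idealr_closed [pred x | x \in P] /\ prime_idealr_closed [pred x | x \in P].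

(* Ass(I), i.e. Ass(A / I): the primes that are annihilators of the class of
   some [f] in A / I. *)
Definition associated_prime I P : Prop :=
  prime_ideal P /\ exists f : A, P = [set g | I (g * f)].

(* The coefficients [c] are redundant for [0 < m]; they make [I ^ 0] the unit
   ideal. *)
Definition ideal_power I m : set A :=
  [set f | exists (n : nat) (c : 'I_n -> A) (g : 'I_n -> 'I_m -> A),
     (forall i j, I (g i j)) /\ f = \sum_(i < n) c i * \prod_(j < m) g i j].

(* J A_P, as a subset of the fraction field of A. *)
Definition localized_ideal J P : set {fraction A} :=
  [set q | exists a b : A, [/\ J a, ~ P b & q = tofrac a / tofrac b]].

Definition symbolic_power I m : set A :=
  [set f | forall P, associated_prime I P ->
     localized_ideal (ideal_power I m) P (tofrac f)].

End SymbolicPowers.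

Section WaldschmidtConstant.
Variables (K : fieldType) (n : nat).
Implicit Types I : set {mpoly K[n]}.

Definition graded_part I (t : nat) : set {mpoly K[n]} :=
  [set f | I f /\ f \is t.-homog].

(* Junk value 0 when no graded part of I is nonzero. *)
Definition initial_degree I : nat :=
  xget 0%N [set t | (exists2 f, graded_part I t f & f != 0) /\
     forall t', (exists2 f, graded_part I t' f & f != 0) -> (t <= t')%N].

(* The term of index 0 is irrelevant to the limit (it is 0, as x / 0 = 0). *)
Definition waldschmidt (R : realType) I : R :=
  limn (fun m : nat => (initial_degree (symbolic_power I m))%:R / m%:R : R).

End WaldschmidtConstant.

Section LinesInP3.
Variable K : fieldType.

(* A line of P^3 is a 2-dimensional linear subspace of K^4, so that [line] is
   the set of points of the Grassmannian of lines in P^3. *)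
Definition line := {U : {vspace 'rV[K]_4} | \dim U == 2%N}.

(* The ideal of the union of the lines [L i]: the polynomials vanishing at all
   homogeneous coordinates [v] of all points of the union. *)
Definition lines_ideal s (L : 'I_s -> line) : set {mpoly K[4]} :=
  [set f | forall (i : 'I_s) (v : 'rV[K]_4),
     v \in val (L i) -> v != 0 -> f.@[v 0] = 0].

(* Pluecker embedding: a line spanned by u and v is sent to the class, in the
   projective space of 4 x 4 matrices, of the alternating matrix of all the
   minors u_j v_k - u_k v_j.  Another basis of the line rescales this matrix by
   a nonzero constant, so the choice of [vbasis] does not affect the vanishing
   of the multihomogeneous polynomials used below. *)
Definition plucker (l : line) : 'M[K]_4 :=
  let u := (vbasis (val l))`_0 in
  let v := (vbasis (val l))`_1 in
  \matrix_(j, k) (u 0 j * v 0 k - u 0 k * v 0 j).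

(* Coordinate (j, k) of the i-th line is the variable of index
   [mxvec_index i (mxvec_index j k)]. *)
Definition plucker_coords s (L : 'I_s -> line) : 'I_(s * (4 * 4)) -> K :=
  mxvec (\matrix_(i < s) mxvec (plucker (L i))) 0.

Definition multihomogeneous s (F : {mpoly K[s * (4 * 4)]}) : Prop :=
  exists d : 'I_s -> nat, forall m : 'X_{1..(s * (4 * 4))}, m \in msupp F ->
    forall i : 'I_s, (\sum_(k < 4 * 4) m (mxvec_index i k))%N = d i.

(* Zariski closed subsets of the product of s Grassmannians, embedded in a
   product of s projective spaces. *)
Definition zariski_closed s (Z : set ('I_s -> line)) : Prop :=
  exists2 S : set {mpoly K[s * (4 * 4)]},
    (forall F, S F -> multihomogeneous F) &
    Z = [set L | forall F, S F -> F.@[plucker_coords L] = 0].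

Definition very_general s (P : set ('I_s -> line)) : Prop :=
  exists Z : nat -> set ('I_s -> line),
    (forall n, zariski_closed (Z n) /\ Z n <> setT) /\
    forall L, ~ (\bigcup_n Z n) L -> P L.

(* The value of a numerical character [phi] at very general s-tuples of lines;
   [x0] is a junk value, used only if [phi] is not constant on any very general
   set of s-tuples. *)
Definition very_general_value s (T : choiceType) (x0 : T)
    (phi : ('I_s -> line) -> T) : T :=
  xget x0 [set x | very_general [set L | phi L = x]].

End LinesInP3.

Definition alpha (K : fieldType) (s : nat) : nat :=
  very_general_value 0%N (fun L : 'I_s -> line K =>
    initial_degree (lines_ideal L)).

Definition alpha_hat (K : fieldType) (R : realType) (s : nat) : R :=
  very_general_value 0 (fun L : 'I_s -> line K =>
    waldschmidt R (lines_ideal L)).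

(* Main.v *)
(* Let T be the least integer with 6 s < (T + 2) (T + 3).  Counting conditions,
   any s lines lie on a surface of degree T, so alpha(s) <= T, and it remains to
   see that a form of degree d vanishing to order m on s very general lines has
   2 d >= (T + 1) m.

   A polynomial lies in the m-th symbolic power of the ideal of the lines iff it
   vanishes to order m along each of them.  In Pluecker coordinates the existence
   of such a form of degree d is the vanishing of minors, so that it either holds
   for all lines or fails for very general ones.  Thus all the initial degrees of
   symbolic powers are constant on a very general set, which is nonempty as K is
   uncountable, and it suffices to bound them for one special configuration; the
   limit exists by Fekete's lemma.

   The special lines are the transversals of two fixed skew lines, distributed on
   the q quadrics x0 x3 = a x1 x2.  By the action of the torus on the transversals,
   a form of degree d may be replaced by a curve of bidegree (d - b, b) on
   P^1 x P^1 with points of multiplicity m, located on the q curves z = a y.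
   As long as d is less than n m for the number n of points on one of
   these curves, that curve splits off, lowering d by 2 and m by 1 at its points.
   With at least j points on each curve and j <= 2 q this forces d >= j m.  For
   s = 5 one takes q = 2, with 3 and 2 points, and gets 3 d >= 8 m. *)
Require Import Defs.
From mathcomp Require Import all_boot all_order all_algebra.
From mathcomp Require Import boolp classical_sets cardinality reals filter.
From mathcomp Require Import pseudometric_structure num_topology.
From mathcomp Require Import separation_axioms.
From mathcomp Require Import mpoly.
From mathcomp Require Import zify ring.

Set Implicit Arguments.
Unset Strict Implicit.
Unset Printing Implicit Defensive.

Import Order.TTheory GRing.Theory Num.Theory.
Import numFieldTopology.Exports.

Local Open Scope ring_scope.

(** * Polynomials with vanishing low coefficients, and avoidance over uncountable fields *)

Definition low_coefs0 (A : nzRingType) (m : nat) (p : {poly A}) : Prop :=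
  forall k, (k < m)%N -> p`_k = 0.

Section LowCoefs.
Variable A : nzRingType.
Implicit Types (p q : {poly A}) (m n : nat).

Lemma low_coefs0_sum (I : Type) (r : seq I) (F : I -> {poly A}) m :
  (forall i, low_coefs0 m (F i)) -> low_coefs0 m (\sum_(i <- r) F i).
Proof. by move=> F0 k lt_km; rewrite coef_sum big1 // => i _; apply: F0. Qed.

Lemma low_coefs0M m n p q :
  low_coefs0 m p -> low_coefs0 n q -> low_coefs0 (m + n) (p * q).
Proof.
move=> p0 q0 k lt_k; rewrite coefM big1 // => i _.
case: (ltnP i m) => [lt_im | le_mi]; first by rewrite p0 ?mul0r.
rewrite q0 ?mulr0 //; have := ltn_ord i; lia.
Qed.

Lemma low_coefs0Ml m p q : low_coefs0 m q -> low_coefs0 m (p * q).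
Proof. by move=> q0; rewrite -[m]add0n; apply: low_coefs0M. Qed.

Lemma low_coefs0_prod n (F : 'I_n -> {poly A}) :
  (forall i, low_coefs0 1 (F i)) -> low_coefs0 n (\prod_(i < n) F i).
Proof.
elim: n F => [|n IHn] F F0; first by [].
rewrite big_ord_recl; apply: (@low_coefs0M 1 n) => //; exact: IHn.
Qed.

Lemma low_coefs0X p m : low_coefs0 1 p -> low_coefs0 m (p ^+ m).
Proof.
move=> p0; elim: m => [|m IHm]; first by [].
by rewrite exprS; apply: (@low_coefs0M 1 m).
Qed.

Lemma low_coefs0P m p : low_coefs0 m p -> exists q, p = q * 'X^m.
Proof.
move=> p0; exists (\poly_(i < size p) p`_(i + m)); apply/polyP => k.
rewrite coefMXn coef_poly; case: ltnP => [/p0 // | le_mk].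
case: ltnP => [|le_pk]; first by rewrite subnK.
by rewrite nth_default // (leq_trans le_pk) ?leq_subr.
Qed.

Lemma low_coefs0_mulX m q : low_coefs0 m.+1 ('X * q) -> low_coefs0 m q.
Proof. by move=> q0 k lt_km; have := q0 k.+1 lt_km; rewrite coefXM. Qed.

End LowCoefs.

(** A factor with nonzero constant coefficient does not change the order at [X = 0] over a domain:
    by strong induction, the coefficient of degree [k] of [p * q] reduces to the constant
    coefficient of [p] times the coefficient of degree [k] of [q]. *)
Lemma low_coefs0_cancel (A : idomainType) m (p q : {poly A}) :
  p`_0 != 0 -> low_coefs0 m (p * q) -> low_coefs0 m q.
Proof.
move=> p0 pq0 k; elim/ltn_ind: k => k IHk lt_km.
have := pq0 k lt_km; rewrite coefM big_ord_recl /= subn0 big1 ?addr0 => [/eqP|i _].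
  by rewrite mulf_eq0 (negbTE p0) => /eqP.
by rewrite IHk ?mulr0 //= /bump /=; have := ltn_ord i; lia.
Qed.

Section CharZero.
Variables (K : fieldType) (charK0 : [pchar K] =i pred0).

Lemma natr_inj_char0 : injective (fun n : nat => n%:R : K).
Proof.
move=> m n /eqP; wlog le_mn : m n / (m <= n)%N => [IH|].
  case/orP: (leq_total m n) => le /eqP mn; first by apply: IH => //; apply/eqP.
  by apply/esym/IH => //; apply/eqP/esym.
rewrite -subr_eq0 -opprB oppr_eq0 -natrB // (iffLR (pcharf0P K) charK0).
rewrite subn_eq0 => le_nm; apply/eqP; by rewrite eqn_leq le_mn le_nm.
Qed.

(** In characteristic 0 the integers below [size p] are distinct roots, one more than a nonzero [p]
    can have. *)
Lemma poly_fun_eq0 (p : {poly K}) : (forall x, p.[x] = 0) -> p = 0.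
Proof.
move=> p0; apply/eqP; apply: contraT => nz_p.
have := @max_poly_roots _ p [seq n%:R | n <- iota 0 (size p)] nz_p.
rewrite size_map size_iota ltnn; apply.
  by apply/allP => x _; apply/rootP.
by rewrite map_inj_uniq ?iota_uniq //; apply: natr_inj_char0.
Qed.

End CharZero.

Lemma horner_mmap (K : comNzRingType) n (q : 'I_n -> {poly K})
    (F : {mpoly K[n]}) (x : K) :
  (mmap polyC q F).[x] = F.@[fun i => (q i).[x]].
Proof.
rewrite /meval /mmap horner_sum; apply: eq_bigr => m _.
rewrite hornerM hornerC /mmap1 horner_prod.
by congr (_ * _); apply: eq_bigr => i _; rewrite horner_exp.
Qed.

(** Uniqueness of digits in base [B]: reduction modulo [B] gives the lowest digit, and division by
    [B] leaves the others to the induction. *)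
Lemma base_expansion_inj B n (f g : 'I_n -> nat) :
  (forall i, f i < B)%N -> (forall i, g i < B)%N ->
  (\sum_i f i * B ^ i = \sum_i g i * B ^ i)%N -> f =1 g.
Proof.
elim: n f g => [|n IHn] f g ltf ltg; first by move=> _ [].
rewrite !big_ord_recl !expn0 !muln1.
have E (h : 'I_n.+1 -> nat) :
    (\sum_(i < n) h (lift ord0 i) * B ^ (lift ord0 i) =
     (\sum_(i < n) h (lift ord0 i) * B ^ i) * B)%N.
  by rewrite big_distrl /=; apply: eq_bigr => i _; rewrite /bump /= add1n expnSr mulnA.
rewrite !E ![(_ ord0 + _)%N]addnC => eq_fg.
have B0 : (0 < B)%N by apply: leq_ltn_trans (ltf ord0).
have e0 : f ord0 = g ord0.
  by have := congr1 (modn^~ B) eq_fg; rewrite /= !modnMDl !modn_small.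
have eS : (\sum_(i < n) f (lift ord0 i) * B ^ i =
           \sum_(i < n) g (lift ord0 i) * B ^ i)%N.
  have := congr1 (divn^~ B) eq_fg.
  by rewrite /= !divnMDl // !divn_small // !addn0.
move=> i; case: (unliftP ord0 i) => [j|] -> //.
exact: (IHn (fun i => f (lift ord0 i)) (fun i => g (lift ord0 i))).
Qed.

Section MPolyFun.
Variables (K : fieldType) (charK0 : [pchar K] =i pred0) (n : nat).

(* Kronecker substitution: [x_i |-> X ^ (B ^ i)] is injective on polynomials of
   degree less than [B]. *)
Lemma mpoly_fun_eq0 (F : {mpoly K[n]}) : (forall x, F.@[x] = 0) -> F = 0.
Proof.
move=> F0; set B := msize F.
pose P : {poly K} := mmap polyC (fun i : 'I_n => 'X^(B ^ i)) F.
have P0 : P = 0.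
  by apply: (poly_fun_eq0 charK0) => x; rewrite horner_mmap F0.
have mB m i : m \in msupp F -> (m i < B)%N.
  move=> /msize_mdeg_lt; apply: leq_ltn_trans.
  by rewrite mdegE (bigD1 i) //= leq_addr.
pose e (m : 'X_{1..n}) := (\sum_i m i * B ^ i)%N.
have eP m : mmap1 (fun i : 'I_n => 'X^(B ^ i)) m = 'X^(e m) :> {poly K}.
  rewrite /mmap1 /e (big_morph _ (exprD 'X) (expr0 'X)).
  by apply: eq_bigr => i _; rewrite -exprM mulnC.
apply/mpolyP => m; rewrite mcoeff0.
case: (boolP (m \in msupp F)) => [mF|]; last exact: memN_msupp_eq0.
have := congr1 (fun p : {poly K} => p`_(e m)) P0.
rewrite coef0 /P /mmap coef_sum (bigD1_seq m) ?msupp_uniq //= eP.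
rewrite coefCM coefXn eqxx mulr1 big_seq_cond big1 ?addr0 // => m' /andP[m'F ne].
rewrite eP coefCM coefXn; case: eqP => [em | _]; last by rewrite mulr0.
case/eqP: ne; apply/mnmP.
by apply: (@base_expansion_inj B) => [i|i|]; rewrite ?mB.
Qed.

End MPolyFun.

Section Avoidance.
Variables (K : closedFieldType) (uncountableK : ~ countable [set: K]%classic).

(** Each root set is finite, so their union is countable and cannot exhaust [K]. *)
Lemma countable_roots (T : countType) (q : T -> {poly K}) :
  (forall t, q t != 0) -> exists c, forall t, (q t).[c] != 0.
Proof.
move=> nz_q; apply: contrapT => no_c; apply: uncountableK.
have cU : countable (\bigcup_t [set x | (q t).[x] = 0])%classic.
  apply: bigcup_countable => // t _.
  have [r def_q] := closed_field_poly_normal (q t).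
  apply: finite_set_countable; apply: (sub_finite_set _ (finite_seq r)).
  move=> x /= qx0; have : root (q t) x by apply/rootP.
  by rewrite def_q rootZ ?lead_coef_eq0 // root_prod_XsubC.
apply: sub_countable cU; apply: subset_card_le => x _.
apply: contrapT => nx; apply: no_c; exists x => t.
by apply/eqP => qx0; apply: nx; exists t.
Qed.

(* The coordinates of the common point are fixed one at a time, the witnesses
   of nonvanishing being changed accordingly. *)
Lemma countable_avoidance (I : finType) (T : countType) (f : T -> (I -> K) -> K) :
  (forall t x i, exists q : {poly K},
     forall c, f t (fun j => if j == i then c else x j) = q.[c]) ->
  (forall t, exists x, f t x != 0) -> exists x, forall t, f t x != 0.
Proof.
move=> polyf nz_f.
(* The coordinates in [r] are fixed for all [t] at once; outside [r] the witness [z] may still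
   depend on [t]. *)
suff H (r : seq I) : exists x : I -> K, forall t, exists2 z, f t z != 0 &
    forall i, i \in r -> z i = x i.
  have [x Hx] := H (enum I); exists x => t; have [z fz zx] := Hx t.
  by have <- : z = x by apply: funext => i; apply: zx; rewrite mem_enum.
elim: r => [|i r [x IHr]].
  by exists (fun=> 0) => t; have [z fz] := nz_f t; exists z.
have {IHr} : forall t, exists z, f t z != 0 /\ (forall i, i \in r -> z i = x i).
  by move=> t; have [z] := IHr t; exists z.
move=> /choice[z Hz].
have : forall t, exists q : {poly K},
    forall c, f t (fun j => if j == i then c else z t j) = q.[c].
  by move=> t; apply: polyf.
move=> /choice[q Hq].
(* [q t] is nonzero because its value at [z t i] is [f t (z t)]. *)
have [t|c Hc] := @countable_roots T q.
  have [+ _] := Hz t; apply: contraNneq => q0.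
  have := Hq t (z t i); rewrite q0 horner0 => <-; apply/eqP; congr (f t _).
  by apply: funext => j; case: eqP => [->|].
exists (fun j => if j == i then c else x j) => t.
exists (fun j => if j == i then c else z t j); first by rewrite Hq.
move=> j; rewrite in_cons; case: eqP => //= _ jr.
by have [_ ->] := Hz t.
Qed.

End Avoidance.

(** * Orders of vanishing along lines and symbolic powers *)

Lemma rmorph_mmap (R : nzRingType) (S T : comNzRingType) n
    (phi : {rmorphism S -> T}) (f : {rmorphism R -> S}) (h : 'I_n -> S)
    (F : {mpoly R[n]}) :
  phi (mmap f h F) = mmap (phi \o f) (phi \o h) F.
Proof.
rewrite /mmap rmorph_sum; apply: eq_bigr => m _; rewrite rmorphM.
rewrite /mmap1 rmorph_prod; congr (_ * _).
by apply: eq_bigr => i _; rewrite rmorphXn.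
Qed.

Lemma eq_mmap (R S : nzRingType) n (f g : R -> S) (h k : 'I_n -> S)
    (F : {mpoly R[n]}) : f =1 g -> h =1 k -> mmap f h F = mmap g k F.
Proof.
move=> fg hk; rewrite /mmap; apply: eq_bigr => m _; rewrite fg.
by rewrite (mmap1_eq _ hk).
Qed.

Lemma mmap_mpolyC_id (R : comNzRingType) n (F : {mpoly R[n]}) :
  mmap (mpolyC n (R := R)) (fun i => 'X_i) F = F.
Proof.
rewrite [RHS]mpolyE /mmap; apply: eq_bigr => m _.
by rewrite mul_mpolyC mpolyXE_id.
Qed.

Section IdealPower.
Variables (A : idomainType) (J : set A).

Lemma ideal_power_term m (c : A) (g : 'I_m -> A) :
  (forall j, J (g j)) -> ideal_power J m (c * \prod_(j < m) g j).
Proof.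
by move=> Jg; exists 1%N, (fun=> c), (fun=> g); rewrite big_ord1.
Qed.

Lemma ideal_power0 m : ideal_power J m 0.
Proof. by exists 0%N, (fun=> 0), (fun _ _ => 0); split=> [[]|]; rewrite ?big_ord0. Qed.

Lemma ideal_powerD m a b :
  ideal_power J m a -> ideal_power J m b -> ideal_power J m (a + b).
Proof.
move=> [n1 [c1 [g1 [Jg1 ->]]]] [n2 [c2 [g2 [Jg2 ->]]]].
exists (n1 + n2)%N, (fun i => match split i with inl j => c1 j | inr j => c2 j end).
exists (fun i => match split i with inl j => g1 j | inr j => g2 j end).
split=> [i j|]; first by case: split.
by rewrite big_split_ord /=; congr (_ + _); apply: eq_bigr => i _;
   [rewrite (unsplitK (inl i)) | rewrite (unsplitK (inr i))].
Qed.

Lemma ideal_power_sum m (I : Type) (r : seq I) (F : I -> A) :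
  (forall i, ideal_power J m (F i)) -> ideal_power J m (\sum_(i <- r) F i).
Proof.
move=> JF; elim: r => [|i r IHr]; rewrite ?big_nil ?big_cons.
  exact: ideal_power0.
exact: ideal_powerD.
Qed.

Lemma ideal_powerM m n a b :
  ideal_power J m a -> ideal_power J n b -> ideal_power J (m + n) (a * b).
Proof.
move=> [n1 [c1 [g1 [Jg1 ->]]]] [n2 [c2 [g2 [Jg2 ->]]]].
rewrite mulr_suml; apply: ideal_power_sum => i.
rewrite mulr_sumr; apply: ideal_power_sum => k.
pose g (x : 'I_(m + n)) := match split x with inl j => g1 i j | inr j => g2 k j end.
have -> : c1 i * \prod_(j < m) g1 i j * (c2 k * \prod_(j < n) g2 k j) =
          c1 i * c2 k * \prod_x g x.
  rewrite mulrACA big_split_ord; congr (_ * (_ * _)); apply: eq_bigr => j _;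
    by rewrite /g (unsplitK (inl j), unsplitK (inr j)).
by apply: ideal_power_term => x; rewrite /g; case: split.
Qed.

Lemma ideal_power_unit a : ideal_power J 0 a.
Proof.
exists 1%N, (fun=> a), (fun _ _ => 0); split=> [i []|] //.
by rewrite big_ord1 big_ord0 mulr1.
Qed.

Lemma ideal_power1 a : J a -> ideal_power J 1 a.
Proof.
move=> Ja; have := @ideal_power_term 1 1 (fun=> a) (fun=> Ja).
by rewrite big_ord1 mul1r.
Qed.

Lemma ideal_power_le m n a : (m <= n)%N -> ideal_power J n a -> ideal_power J m a.
Proof.
move=> /subnKC <- [k [c [g [Jg ->]]]]; apply: ideal_power_sum => i.
rewrite big_split_ord mulrA mulrAC.
exact: (ideal_power_term _ (g := fun j => g i (lshift (n - m) j))).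
Qed.

End IdealPower.

Lemma sub_ideal_power (A : idomainType) (I J : set A) m (a : A) :
  (forall b, I b -> J b) -> ideal_power I m a -> ideal_power J m a.
Proof.
by move=> IJ [n [c [g [Ig ->]]]]; exists n, c, g; split=> // i j; apply: IJ.
Qed.

Definition along (K : fieldType) n (F : {mpoly K[n]}) (p v : 'rV[K]_n) :
    {poly K} := mmap polyC (fun c => (p 0 c)%:P + v 0 c *: 'X) F.

(** Multiplicity at least [m] at every point of [U], measured on all lines through the point rather
    than by derivatives. *)
Definition vanish_order (K : fieldType) n (m : nat) (F : {mpoly K[n]})
    (U : {vspace 'rV[K]_n}) : Prop :=
  forall p, p \in U -> forall v, low_coefs0 m (along F p v).

Definition vanishing_ideal (K : fieldType) n (U : {vspace 'rV[K]_n}) :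
    set {mpoly K[n]} :=
  [set F | forall v : 'rV[K]_n, v \in U -> v != 0 -> F.@[v 0] = 0]%classic.

Section Along.
Variables (K : fieldType) (n : nat).
Implicit Types (F G : {mpoly K[n]}) (U : {vspace 'rV[K]_n}) (p v : 'rV[K]_n).

Lemma horner_along F p v x : (along F p v).[x] = F.@[(p + x *: v) 0].
Proof.
rewrite horner_mmap; apply: meval_eq => i.
by rewrite !hornerE !mxE mulrC.
Qed.

Lemma alongM F G p v : along (F * G) p v = along F p v * along G p v.
Proof. exact: rmorphM. Qed.

Lemma along_coef0 F p v : (along F p v)`_0 = F.@[p 0].
Proof. by rewrite -horner_coef0 horner_along scale0r addr0. Qed.

Lemma vanish_orderM m k F G U :
  vanish_order m F U -> vanish_order k G U -> vanish_order (m + k) (F * G) U.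
Proof. by move=> F0 G0 p Up v; rewrite alongM; apply: low_coefs0M; auto. Qed.

End Along.

(** * Order of vanishing along a linear subspace and powers of its ideal *)

Section LinearSubspace.
Variables (K : fieldType) (charK0 : [pchar K] =i pred0) (n : nat).
Variable U : {vspace 'rV[K]_n}.
Implicit Types (F G : {mpoly K[n]}) (p v : 'rV[K]_n).
Local Notation J := (vanishing_ideal U).

Definition proj_form (j : 'I_n) : {mpoly K[n]} :=
  \sum_i (projv U (delta_mx 0 i)) 0 j *: 'X_i.

Lemma proj_formE (z : 'rV[K]_n) j : (proj_form j).@[z 0] = (projv U z) 0 j.
Proof.
rewrite {2}[z]row_sum_delta raddf_sum [projv U _]linear_sum summxE.
by apply: eq_bigr => i _; rewrite /= mevalZ mevalXU linearZ mxE mulrC.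
Qed.

(** Restriction to [U] is encoded as composition with the projection onto [U], so that its values
    stay in the domain [{mpoly K[n]}]. *)
Definition restriction F : {mpoly K[n]} := mmap (mpolyC n (R := K)) proj_form F.

Lemma restrictionM F G : restriction (F * G) = restriction F * restriction G.
Proof. exact: rmorphM. Qed.

Lemma restriction_prod (I : Type) (r : seq I) (P : pred I) (F : I -> {mpoly K[n]}) :
  restriction (\prod_(i <- r | P i) F i) = \prod_(i <- r | P i) restriction (F i).
Proof. exact: rmorph_prod. Qed.

Lemma meval_restriction F (z : 'rV[K]_n) :
  (restriction F).@[z 0] = F.@[(projv U z) 0].
Proof.
rewrite /restriction rmorph_mmap; apply: eq_mmap => [c|j] /=.
  by rewrite mevalC.
exact: proj_formE.
Qed.

(* Deformation from the restriction of [F] to [U], at [X = 0], to [F] itself, at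
   [X = 1]: it contracts the fibres of the projection to [U]. *)
Definition deformation F : {poly {mpoly K[n]}} :=
  mmap (polyC \o mpolyC n (R := K))
    (fun j => (proj_form j)%:P + ('X_j - proj_form j)%:P * 'X) F.

Lemma deformationM F G : deformation (F * G) = deformation F * deformation G.
Proof. exact: rmorphM. Qed.

Lemma map_deformation F (z : 'rV[K]_n) :
  map_poly (meval (z 0)) (deformation F) = along F (projv U z) (z - projv U z).
Proof.
rewrite /deformation rmorph_mmap; apply: eq_mmap => [c|j] /=.
  by rewrite map_polyC /= mevalC.
rewrite rmorphD rmorphM /= map_polyX !map_polyC /= proj_formE; congr (_ + _).
by rewrite -mul_polyC mevalB mevalXU proj_formE !mxE.
Qed.

Lemma coef0_deformation F : (deformation F)`_0 = restriction F.
Proof.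
rewrite -horner_coef0 -[LHS]/(horner_eval _ _) rmorph_mmap.
by apply: eq_mmap => [c|j] /=; rewrite /horner_eval !hornerE.
Qed.

Lemma horner1_deformation F : (deformation F).[1] = F.
Proof.
rewrite -[LHS]/(horner_eval _ _) rmorph_mmap -[RHS]mmap_mpolyC_id.
apply: eq_mmap => [c|j] /=; rewrite /horner_eval.
  by rewrite hornerC.
by rewrite hornerD hornerM hornerX !hornerC mulr1 addrC subrK.
Qed.

Lemma deformation_low_coefs m F :
  vanish_order m F U -> low_coefs0 m (deformation F).
Proof.
move=> F0 k lt_km; apply: (mpoly_fun_eq0 charK0) => x.
pose z : 'rV[K]_n := \row_j x j.
have -> : ((deformation F)`_k).@[x] = ((deformation F)`_k).@[z 0].
  by apply: meval_eq => j; rewrite mxE.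
by rewrite -(coef_map (meval (z 0))) map_deformation F0 ?memv_proj.
Qed.

(** Rees algebra argument: the polynomials whose coefficient of degree [k] lies in [J ^ k] for all
    [k] form a ring, which contains the constants and the products of ['X] with
    ['X_j - proj_form j], an element of [J]. *)
Lemma deformation_ideal_power F k : ideal_power J k (deformation F)`_k.
Proof.
pose rees (p : {poly {mpoly K[n]}}) := forall k, ideal_power J k p`_k.
have reesC a : rees a%:P.
  move=> [|i]; rewrite coefC /=; first exact: ideal_power_unit.
  exact: ideal_power0.
have reesD (p q : {poly {mpoly K[n]}}) : rees p -> rees q -> rees (p + q).
  by move=> Rp Rq i; rewrite coefD; apply: ideal_powerD.
have reesM (p q : {poly {mpoly K[n]}}) : rees p -> rees q -> rees (p * q).
  move=> Rp Rq i; rewrite coefM; apply: ideal_power_sum => j.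
  have -> : ideal_power J i = ideal_power J (j + (i - j)).
    by rewrite subnKC // -ltnS.
  exact: ideal_powerM.
have reesX (p : {poly {mpoly K[n]}}) e : rees p -> rees (p ^+ e).
  by move=> Rp; elim: e => [|e IHe]; [exact: (reesC 1) | rewrite exprS; apply: reesM].
suff : rees (deformation F) by exact.
rewrite /deformation /mmap; apply: (big_ind rees); [exact: (reesC 0) | exact: reesD | ].
move=> m _; apply: (@reesM); first exact: reesC.
rewrite /mmap1; apply: (big_ind rees); [exact: (reesC 1) | exact: reesM | ].
move=> j _; apply: (@reesX); apply: (@reesD) => // i.
rewrite coefMX coefC; case: i => [|[|i]] /=; try exact: ideal_power0.
apply: ideal_power1 => v Uv _.
by rewrite mevalB mevalXU proj_formE projv_id // subrr.
Qed.

(** At [X = 1], [F] is the sum of the coefficients of its deformation: those of index below [m]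
    vanish, the others lie in [J ^ m]. *)
Lemma deformation_low_coefs_ideal_power m F :
  low_coefs0 m (deformation F) -> ideal_power J m F.
Proof.
move=> F0; rewrite -[F]horner1_deformation horner_coef.
apply: ideal_power_sum => k; rewrite expr1n mulr1.
case: (ltnP k m) => [/F0 ->|le_mk]; first exact: ideal_power0.
exact: ideal_power_le le_mk (deformation_ideal_power F k).
Qed.

Lemma vanish_order_ideal_power m F : vanish_order m F U -> ideal_power J m F.
Proof. by move=> /deformation_low_coefs /deformation_low_coefs_ideal_power. Qed.

Hypothesis U_neq0 : U != 0%VS.

Lemma vanishing_ideal_meval F v : J F -> v \in U -> F.@[v 0] = 0.
Proof.
move=> JF Uv; case: (eqVneq v 0) => [{v Uv}->|]; last exact: JF.
have nz_u : vpick U != 0 by rewrite vpick0.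
(* The origin is excluded from the definition of [J]; the factor ['X] covers the parameter 0, where
   nothing is known yet. *)
have : 'X * along F 0 (vpick U) = 0.
  apply: (poly_fun_eq0 charK0) => x; rewrite hornerM hornerX horner_along add0r.
  case: (eqVneq x 0) => [->|nz_x]; first by rewrite mul0r.
  rewrite JF ?mulr0 ?scaler_eq0 ?negb_or ?nz_x //.
  by rewrite memvZ ?memv_pick.
move/eqP; rewrite mulf_eq0 polyX_eq0 /= => /eqP F0.
by rewrite -(along_coef0 F 0 (vpick U)) F0 coef0.
Qed.

Lemma vanishing_idealP F : J F <-> restriction F = 0.
Proof.
split=> [JF|F0 v Uv _].
  apply: (mpoly_fun_eq0 charK0) => x; pose z : 'rV[K]_n := \row_j x j.
  have -> : (restriction F).@[x] = (restriction F).@[z 0].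
    by apply: meval_eq => j; rewrite mxE.
  by rewrite meval_restriction vanishing_ideal_meval ?memv_proj.
by rewrite -(projv_id Uv) -meval_restriction F0 meval0.
Qed.

Lemma ideal_power_vanish_order m F : ideal_power J m F -> vanish_order m F U.
Proof.
move=> [k [c [g [Jg ->]]]] p Up v.
have -> : along (\sum_(i < k) c i * \prod_(j < m) g i j) p v =
          \sum_(i < k) along (c i) p v * \prod_(j < m) along (g i j) p v.
  rewrite /along rmorph_sum; apply: eq_bigr => i _.
  by rewrite rmorphM rmorph_prod.
apply: low_coefs0_sum => i; apply/low_coefs0Ml/low_coefs0_prod => j [|//] _.
by rewrite along_coef0; apply: vanishing_ideal_meval.
Qed.

(** The constant coefficient of [deformation G] is the restriction of [G], nonzero since [G] is not
    in [J], so [low_coefs0_cancel] applies. *)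
Lemma vanish_order_cancel m F G :
  ~ J G -> vanish_order m (G * F) U -> vanish_order m F U.
Proof.
move=> nJG /deformation_low_coefs; rewrite deformationM => GF0.
have nz_G : (deformation G)`_0 != 0.
  by rewrite coef0_deformation; apply/eqP => /vanishing_idealP.
apply/ideal_power_vanish_order/deformation_low_coefs_ideal_power.
exact: low_coefs0_cancel GF0.
Qed.

(** [J] is the kernel of the multiplicative map [restriction] into a domain. *)
Lemma vanishing_ideal_prime : prime_ideal J.
Proof.
split; first split.
- by rewrite !inE => v _ _; rewrite meval0.
- rewrite !inE; apply/negP => /set_mem J1.
  have := J1 (vpick U) (memv_pick _); rewrite vpick0 => /(_ U_neq0) /eqP.
  by rewrite meval1 oner_eq0.
- move=> a u v; rewrite !inE => Ju Jv w Uw nz_w.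
  by rewrite mevalD mevalM Ju ?Jv // mulr0 addr0.
move=> u v; rewrite !inE => /vanishing_idealP /eqP.
rewrite restrictionM mulf_eq0 => /orP[] /eqP /vanishing_idealP /mem_set ->;
  by rewrite ?orbT.
Qed.

End LinearSubspace.

(** * Associated primes and symbolic powers of the ideal of a union of lines *)

Section SymbolicPowerOfLines.
Variables (K : fieldType) (charK0 : [pchar K] =i pred0) (s : nat).
Variable L : 'I_s -> line K.
Local Notation J i := (vanishing_ideal (val (L i))).

Lemma line_neq0 (l : line K) : val l != 0%VS.
Proof. by have := valP l; rewrite -dimv_eq0 => /eqP ->. Qed.

Lemma lines_idealP F : lines_ideal L F <-> forall i, J i F.
Proof. by split=> IF i v; apply: IF. Qed.

(** Some point [p] of [l1] is off [l2], as both have the same dimension; a coordinate [j] in which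
    [p] differs from its projection to [l2] gives the linear form ['X_j - proj_form (val l2) j]. *)
Lemma separating_form (l1 l2 : line K) : val l1 != val l2 ->
  exists2 h, vanishing_ideal (val l2) h & ~ vanishing_ideal (val l1) h.
Proof.
move=> ne_l12; have : ~~ (val l1 <= val l2)%VS.
  apply: contra ne_l12 => sl12.
  by rewrite eqEdim sl12 (eqP (valP l1)) (eqP (valP l2)).
move=> /subvPn[p l1p nl2p].
have [j ne_j] : exists j, (p - projv (val l2) p) 0 j != 0.
  apply/existsP; apply: contraR nl2p; rewrite negb_exists => /forallP p0.
  suff -> : p = projv (val l2) p by apply: memv_proj.
  apply/eqP; rewrite -subr_eq0; apply/eqP/rowP => j.
  by rewrite [RHS]mxE; apply/eqP; rewrite -[_ == _]negbK.
exists ('X_j - proj_form (val l2) j).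
  by move=> v l2v _; rewrite mevalB mevalXU proj_formE projv_id // subrr.
move=> /(vanishing_ideal_meval charK0 (line_neq0 l1)) /(_ l1p) /eqP.
by rewrite mevalB mevalXU proj_formE; move: ne_j; rewrite !mxE => /negbTE ->.
Qed.

(** Product of separating forms. The family [L] may repeat a line, hence the comparison of subspaces
    instead of indices. *)
Lemma separating_poly i : exists2 g, ~ J i g &
  forall j, val (L j) != val (L i) -> J j g.
Proof.
have : forall j, exists h, val (L i) != val (L j) -> J j h /\ ~ J i h.
  move=> j; case: (boolP (val (L i) != val (L j))) => [ne|_]; last by exists 0.
  by have [h] := separating_form ne; exists h.
move=> /choice[h Hh]; exists (\prod_(j | val (L i) != val (L j)) h j).
  move=> /(vanishing_idealP charK0 (line_neq0 (L i))) /eqP.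
  rewrite restriction_prod => /prodf_eq0[j ne_ij /eqP h0].
  by have [_ []] := Hh j ne_ij; apply/(vanishing_idealP charK0 (line_neq0 (L i))).
move=> j ne_ji; have ne_ij : val (L i) != val (L j) by rewrite eq_sym.
move=> v Lv nz_v; rewrite (bigD1 j) //= mevalM.
by have [/(_ v Lv nz_v) -> _] := Hh j ne_ij; rewrite mul0r.
Qed.

(** [J i] is the annihilator of the class of the separating polynomial [g]: as [g] vanishes on all
    other lines but not on line [i], [h * g] is in the ideal iff [h] is in [J i]. *)
Lemma line_associated_prime i : associated_prime (lines_ideal L) (J i).
Proof.
split; first exact (vanishing_ideal_prime charK0 (line_neq0 (L i))).
have [g nJg Jg] := separating_poly i; exists g; apply/predeqP => h; split.
  move=> Jh; apply/lines_idealP => j v Lv nz_v; rewrite mevalM.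
  case: (eqVneq (val (L j)) (val (L i))) => [eji | /Jg ->]; rewrite ?mulr0 //.
  by rewrite Jh ?mul0r -?eji.
move=> /lines_idealP /(_ i).
move=> /(vanishing_idealP charK0 (line_neq0 (L i))) /eqP.
rewrite restrictionM mulf_eq0.
by case/orP => /eqP /(vanishing_idealP charK0 (line_neq0 (L i))).
Qed.

Lemma associated_prime_line P :
  associated_prime (lines_ideal L) P -> exists i, P = J i.
Proof.
move=> [[[_ nP1 linP] primeP] [f defP]].
have nP1' : ~ P 1 by move: nP1; rewrite inE => /negP nP1 P1; apply/nP1/mem_set.
have PM u v : P (u * v) -> P u \/ P v.
  move=> Puv; have := primeP u v; rewrite !inE => /(_ Puv) /orP.
  by case=> /set_mem; [left | right].
(* Otherwise each line on which [f] is not identically zero has some [h i] in [J i] outside [P];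
   their product times [f] vanishes on all lines, so the product lies in the prime [P]. *)
have [i nJf sJP] : exists2 i, ~ J i f & forall h, J i h -> P h.
  apply: contrapT => no_i.
  have : forall i, exists h, ~ J i f -> J i h /\ ~ P h.
    move=> i; apply: contrapT => no_h; apply: no_i; exists i.
      by move=> Jf; apply: no_h; exists 0.
    move=> h Jh; apply: contrapT => nPh; apply: no_h; exists h; by [].
  move=> /choice[h Hh].
  pose c i := `[< J i f >].
  have : ~ P (\prod_(i | ~~ c i) h i).
    apply: (big_ind (fun u => ~ P u)) => // [u v nPu nPv /PM[] //|i /asboolPn nJf].
    by have [] := Hh i nJf.
  apply; rewrite defP; apply/lines_idealP => i v Lv nz_v; rewrite mevalM.
  case: (boolP (c i)) => [/asboolP Jf | nc]; first by rewrite Jf ?mulr0.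
  have [/(_ v Lv nz_v) h0 _] := Hh i (asboolPn _ nc).
  by rewrite (bigD1 i) //= mevalM h0 !mul0r.
exists i; apply/predeqP => h; split; last exact: sJP.
rewrite defP => /lines_idealP /(_ i).
move=> /(vanishing_idealP charK0 (line_neq0 (L i))) /eqP.
rewrite restrictionM mulf_eq0.
by case/orP => /eqP /(vanishing_idealP charK0 (line_neq0 (L i))).
Qed.

(** In the localization at [J i], the denominator does not vanish on the line and can be cancelled.
    Conversely, if [F] is in the [m]-th power of [J i] and [g] vanishes exactly on the other lines
    among the [L j], then [F * g ^+ m] is in the [m]-th power of the whole ideal. *)
Lemma symbolic_powerP m F :
  symbolic_power (lines_ideal L) m F <->
  forall i, vanish_order m F (val (L i)).
Proof.
split=> [symF i | ordF P].
  have [a [b [Ia nJb]]] := symF _ (line_associated_prime i).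
  have nz_b : b != 0.
    by apply/eqP => b0; apply: nJb => v _ _; rewrite b0 meval0.
  move/eqP; rewrite -(inj_eq (mulIf (_ : tofrac b != 0))) ?tofrac_eq0 //.
  rewrite divfK ?tofrac_eq0 // -tofracM tofrac_eq => /eqP def_a.
  apply: (vanish_order_cancel charK0 (line_neq0 (L i)) nJb).
  apply: (ideal_power_vanish_order charK0 (line_neq0 (L i))).
  rewrite mulrC def_a; apply: sub_ideal_power Ia => g /lines_idealP; exact.
move=> /associated_prime_line[i ->].
have [g nJg Jg] := separating_poly i.
have [k [c [h [Jh defF]]]] := vanish_order_ideal_power charK0 (ordF i).
exists (F * g ^+ m), (g ^+ m); split.
- rewrite defF; exists k, c, (fun a b => h a b * g); split.
    move=> a b; apply/lines_idealP => j v Lv nz_v; rewrite mevalM.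
    case: (eqVneq (val (L j)) (val (L i))) => [eji | /Jg ->]; rewrite ?mulr0 //.
    by rewrite Jh ?mul0r -?eji.
  rewrite mulr_suml; apply: eq_bigr => a _; rewrite -mulrA; congr (_ * _).
  by rewrite big_split prodr_const card_ord.
- rewrite (vanishing_idealP charK0 (line_neq0 (L i))) /restriction rmorphXn.
  by move/eqP; rewrite expf_eq0 => /andP[_ /eqP /(vanishing_idealP charK0 (line_neq0 (L i)))].
rewrite tofracM mulfK // tofrac_eq0 expf_eq0 negb_and; apply/orP; right.
by apply/eqP => g0; apply: nJg => v _ _; rewrite g0 meval0.
Qed.

End SymbolicPowerOfLines.

(** * Multidegrees and minors *)

Section LinearConditions.
Variable K : fieldType.

(** Rows are chosen one at a time: while there are fewer than [N], a nonzero column of the cokernel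
    is killed by the rows already chosen, and a row that does not kill it is independent of them. *)
Lemma full_rank_rows (W : Type) N (r : W -> 'rV[K]_N) :
  (forall c : 'cV[K]_N, c != 0 -> exists w, r w *m c != 0) ->
  exists w : 'I_N -> W, \det (\matrix_i r (w i)) != 0.
Proof.
move=> r_sep.
suff H k : (k <= N)%N -> exists w : 'I_k -> W, row_free (\matrix_i r (w i)).
  have [w free_w] := H N (leqnn N); exists w.
  by rewrite -unitfE -unitmxE -row_free_unit.
elim: k => [|k IHk] lt_kN.
  have w0 : 'I_0 -> W by case.
  by exists w0; rewrite /row_free -leqn0 rank_leq_row.
have [w free_w] := IHk (ltnW lt_kN); set M := \matrix_i r (w i) in free_w.
have [j nz_c] : exists j, col j (cokermx M) != 0.
  apply/existsP; apply: contraT; rewrite negb_exists => /forallP c0.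
  have : \rank (cokermx M) == 0%N.
    rewrite mxrank_eq0; apply/eqP/matrixP => a j; rewrite mxE.
    by have := c0 j; rewrite negbK => /eqP/matrixP/(_ a 0); rewrite !mxE.
  by rewrite mxrank_coker (eqP free_w) subn_eq0 leqNgt lt_kN.
have [w0 nz_w0] := r_sep _ nz_c.
have Mc : M *m col j (cokermx M) = 0.
  by rewrite colE mulmxA mulmx_coker mul0mx.
exists (fun i : 'I_(1 + k) => match split i with inl _ => w0 | inr i' => w i' end).
have -> : \matrix_i r (match split i with inl _ => w0 | inr i' => w i' end) =
          col_mx (r w0) M.
  apply/matrixP => a b; rewrite !mxE; case: split => c; rewrite ?mxE //.
  by rewrite ord1.
suff H (u : 'rV_(1 + k)) : u *m col_mx (r w0) M = 0 -> u = 0.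
  exact: inj_row_free H.
rewrite -[u]hsubmxK mul_row_col => uM0.
have u1 : lsubmx u = 0.
  have := congr1 (fun x => x *m col j (cokermx M)) uM0.
  rewrite mulmxDl -!mulmxA Mc mulmx0 addr0 mul0mx => /rowP/(_ 0).
  rewrite [in X in X -> _]mxE big_ord1 [RHS]mxE => /eqP.
  rewrite mulf_eq0 => /orP[/eqP u0|/eqP c0].
    by apply/rowP => a; rewrite !ord1 u0 mxE.
  by case/eqP: nz_w0; apply/matrixP => a b; rewrite !ord1 c0 mxE.
move: uM0; rewrite u1 mul0mx add0r => u2M.
suff -> : rsubmx u = 0 by rewrite row_mx0.
by apply: (row_free_inj free_w); rewrite u2M mul0mx.
Qed.

End LinearConditions.

Section MonomialBasis.
Variables (R : nzRingType) (n t : nat).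

Lemma homog_monomials : exists2 B : seq 'X_{1..n.+1},
  uniq B & size B = 'C(t + n, t) /\ forall m, (m \in B) = (mdeg m == t).
Proof.
exists [seq s2m u | u : t.-tuple 'I_n.+1 <- enum (basis n.+1 t)].
  exact: uniq_basis.
by split=> [|m]; [exact: size_basis | rewrite basis_cover].
Qed.

Lemma homog_expansion (B : seq 'X_{1..n}) (F : {mpoly R[n]}) : uniq B ->
  (forall m, (m \in B) = (mdeg m == t)) -> F \is t.-homog ->
  F = \sum_(i < size B) F@_(nth 0%MM B i) *: 'X_[nth 0%MM B i].
Proof.
move=> uB memB homF.
rewrite -(big_mkord xpredT (fun i => F@_(nth 0%MM B i) *: 'X_[nth 0%MM B i])).
rewrite -(big_nth 0%MM xpredT (fun m => F@_m *: 'X_[m])).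
apply/mpolyP => m; rewrite raddf_sum /=.
case: (boolP (m \in B)) => [mB | nmB].
  rewrite (bigD1_seq m) //= mcoeffZ mcoeffX eqxx mulr1 big1 ?addr0 // => m' ne.
  by rewrite mcoeffZ mcoeffX (negbTE ne) mulr0.
rewrite (dhomog_nemf_coeff homF) -?memB // big_seq big1 // => m' m'B.
rewrite mcoeffZ mcoeffX; case: eqP => [em|]; last by rewrite mulr0.
by rewrite -em m'B in nmB.
Qed.

Lemma homog_sum (B : seq 'X_{1..n}) (c : 'I_(size B) -> R) :
  (forall m, (m \in B) = (mdeg m == t)) ->
  \sum_(i < size B) c i *: 'X_[nth 0%MM B i] \is t.-homog.
Proof.
move=> memB; apply: rpred_sum => i _; apply: rpredZ.
by rewrite dhomogX -memB mem_nth.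
Qed.

Lemma homog_sum_coef (B : seq 'X_{1..n}) (c : 'I_(size B) -> R) (i : 'I_(size B)) : uniq B ->
  (\sum_(i < size B) c i *: 'X_[nth 0%MM B i])@_(nth 0%MM B i) = c i.
Proof.
move=> uB; rewrite raddf_sum (bigD1 i) //= mcoeffZ mcoeffX eqxx mulr1.
rewrite big1 ?addr0 // => j ne_ji.
by rewrite mcoeffZ mcoeffX nth_uniq // -[_ == _ :> nat]/(j == i) (negbTE ne_ji) mulr0.
Qed.

End MonomialBasis.

Section Multidegree.
Variables (K : fieldType) (s : nat).
Implicit Types (d e : 'I_s -> nat) (F G : {mpoly K[s * (4 * 4)]}).

Definition has_multidegree d F : Prop :=
  forall m, m \in msupp F -> forall i, (\sum_(k < 4 * 4) m (mxvec_index i k))%N = d i.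

Lemma multidegree0 d : has_multidegree d 0.
Proof. by move=> m; rewrite msupp0. Qed.

Lemma multidegreeD d F G :
  has_multidegree d F -> has_multidegree d G -> has_multidegree d (F + G).
Proof.
by move=> dF dG m /msuppD_le; rewrite mem_cat => /orP[/dF|/dG].
Qed.

Lemma multidegreeZ d c F : has_multidegree d F -> has_multidegree d (c *: F).
Proof. by move=> dF m /msuppZ_le /dF. Qed.

Lemma multidegreeM d e F G :
  has_multidegree d F -> has_multidegree e G ->
  has_multidegree (fun i => d i + e i)%N (F * G).
Proof.
move=> dF eG m /msuppM_le /allpairsP[[m1 m2] /= [m1F m2G ->]] i.
by rewrite -(dF m1 m1F) -(eG m2 m2G) -big_split; apply: eq_bigr => k _; rewrite mnmDE.
Qed.

Lemma multidegreeC c : has_multidegree (fun=> 0%N) c%:MP.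
Proof.
move=> m; rewrite msuppC; case: ifP => // _; rewrite inE => /eqP -> i.
by rewrite big1 // => k _; rewrite mnm0E.
Qed.

(** Read off from the entries of a matrix unit, over [rat] for definiteness. *)
Lemma mxvec_index_eq m n (i l : 'I_m) (k j : 'I_n) :
  (mxvec_index l k == mxvec_index i j) = (l == i) && (k == j).
Proof.
have := mxvecE (delta_mx i j : 'M[rat]_(m, n)) l k.
rewrite mxvec_delta !mxE eqxx /=.
by case: (_ == _ :> 'I_(m * n)); case: (_ && _).
Qed.

Lemma multidegreeX l k :
  has_multidegree (fun i => (i == l) : nat) 'X_(mxvec_index l k).
Proof.
move=> m; rewrite msuppX inE => /eqP -> i.
transitivity (\sum_(k' < 4 * 4) ((i == l) && (k' == k) : nat))%N.
  apply: eq_bigr => k' _.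
  by rewrite mnm1E mxvec_index_eq [l == i]eq_sym [k == k']eq_sym.
case: (i == l) => /=; last by rewrite big1.
by rewrite (bigD1 k) //= eqxx big1 ?addn0 // => k' /negbTE ->.
Qed.

Lemma multidegree_sum (I : Type) (r : seq I) d (F : I -> {mpoly K[s * (4 * 4)]}) :
  (forall i, has_multidegree d (F i)) -> has_multidegree d (\sum_(i <- r) F i).
Proof.
move=> dF; apply: (big_ind (has_multidegree d)) => //.
  exact: multidegree0.
exact: multidegreeD.
Qed.

Lemma eq_multidegree d e F : d =1 e -> has_multidegree d F -> has_multidegree e F.
Proof. by move=> de dF m mF i; rewrite -de; apply: dF. Qed.

Lemma multidegree_prod (I : Type) (r : seq I) (d : I -> 'I_s -> nat)
    (F : I -> {mpoly K[s * (4 * 4)]}) :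
  (forall j, has_multidegree (d j) (F j)) ->
  has_multidegree (fun i => \sum_(j <- r) d j i)%N (\prod_(j <- r) F j).
Proof.
move=> dF; elim: r => [|j r IHr].
  rewrite big_nil -mpolyC1; apply: (@eq_multidegree (fun=> 0%N)) => [i|].
    by rewrite big_nil.
  exact: multidegreeC.
rewrite big_cons; apply: eq_multidegree (multidegreeM (dF j) IHr) => i.
by rewrite big_cons.
Qed.

(** The multidegree of an entry depends only on its row, so all terms of the Leibniz expansion have
    the same multidegree. *)
Lemma multidegree_det N (A : 'M[{mpoly K[s * (4 * 4)]}]_N) (d : 'I_N -> 'I_s -> nat) :
  (forall a b, has_multidegree (d a) (A a b)) ->
  has_multidegree (fun i => \sum_a d a i)%N (\det A).
Proof.
move=> dA; apply: multidegree_sum => sigma.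
rewrite -signr_odd mulr_sign; case: ifP => _; last exact: multidegree_prod.
by rewrite -scaleN1r; apply/multidegreeZ/multidegree_prod.
Qed.

(** Used for a change of basis of the lines, which rescales the Pluecker coordinates of line [i] by
    [c i]. *)
Lemma multidegree_meval d F (c : 'I_s -> K) (x y : 'I_(s * (4 * 4)) -> K) :
  has_multidegree d F ->
  (forall i k, y (mxvec_index i k) = c i * x (mxvec_index i k)) ->
  F.@[y] = (\prod_i c i ^+ d i) * F.@[x].
Proof.
move=> dF yx; rewrite !mevalE mulr_sumr; apply: eq_big_seq => m mF.
rewrite mulrCA; congr (_ * _).
have E (z : 'I_(s * (4 * 4)) -> K) :
    \prod_j z j = \prod_i \prod_(k < 4 * 4) z (mxvec_index i k).
  rewrite pair_big /= (reindex _ (curry_mxvec_bij _ _)) /=.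
  by apply: eq_bigr => -[].
rewrite !E -big_split /=; apply: eq_bigr => i _.
rewrite -(dF m mF i) -prodrXr -big_split; apply: eq_bigr => k _.
by rewrite yx exprMn.
Qed.

End Multidegree.

(** * Very general tuples of lines *)

Section PluckerCoordinates.
Variable K : fieldType.
Implicit Types (l : line K) (p u v : 'rV[K]_4).

Definition minors u v : 'M[K]_4 := \matrix_(j, k) (u 0 j * v 0 k - u 0 k * v 0 j).

Lemma vbasis_lineE l :
  vbasis (val l) = [:: (vbasis (val l))`_0; (vbasis (val l))`_1] :> seq _.
Proof.
have : size (vbasis (val l)) = 2%N by rewrite size_tuple (eqP (valP l)).
by case: (tval _) => [|x [|y [|]]].
Qed.

Lemma line_basisP l p :
  reflect (exists a b, p = a *: (vbasis (val l))`_0 + b *: (vbasis (val l))`_1)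
          (p \in val l).
Proof.
have defl : val l = (<[(vbasis (val l))`_0]> + <[(vbasis (val l))`_1]>)%VS.
  rewrite -[LHS](span_basis (vbasisP (val l))) [in LHS]vbasis_lineE.
  by rewrite span_cons span_seq1.
rewrite (congr1 (fun V : {vspace 'rV[K]_4} => p \in V) defl).
apply: (iffP memv_addP) => [[x /vlineP[a ->] [y /vlineP[b ->] ->]]|[a [b ->]]].
  by exists a, b.
exists (a *: (vbasis (val l))`_0); first by rewrite memvZ ?memv_line.
by exists (b *: (vbasis (val l))`_1); rewrite ?memvZ ?memv_line.
Qed.

(** Contraction of the bivector of [u] and [v] with the linear form [w]: the result lies in the span
    of [u] and [v]. *)
Lemma mul_minors (w u v : 'rV[K]_4) :
  w *m minors u v = (u *m w^T) 0 0 *: v - (v *m w^T) 0 0 *: u.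
Proof.
apply/rowP => k; rewrite !mxE !mulr_suml -sumrB; apply: eq_bigr => j _.
by rewrite !mxE; ring.
Qed.

(** The line is the row space of its Pluecker matrix, which parametrizes its points linearly in the
    Pluecker coordinates. *)
Lemma line_plucker l p :
  p \in val l <-> exists w : 'rV[K]_4, p = w *m plucker l.
Proof.
have plE : plucker l = minors (vbasis (val l))`_0 (vbasis (val l))`_1 by [].
split=> [/line_basisP[a [b ->]]|[w ->]]; last first.
  rewrite plE mul_minors; apply/line_basisP.
  by eexists; eexists; rewrite addrC -scaleNr; reflexivity.
pose A : 'M[K]_(2, 4) := \matrix_i nth 0 (vbasis (val l)) i.
have freeA : row_free A.
  apply: inj_row_free => x /rowP xA0.
  have := basis_free (vbasisP (val l)); rewrite vbasis_lineE.
  move=> /(@freeP _ _ _ [tuple (vbasis (val l))`_0; (vbasis (val l))`_1])/(_ (x 0)) x0.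
  apply/rowP => i; rewrite x0 ?mxE //; apply/rowP => k.
  transitivity ((x *m A) 0 k); last by rewrite xA0.
  (* The two rows of [A] are the basis vectors, so [x *m A] is their combination with coefficients
     [x]. *)
  rewrite summxE [RHS]mxE; apply: eq_bigr => -[[|[|//]] lt_i] _; by rewrite !mxE.
have [B AB1] := row_freeP freeA.
(* By [mul_minors], the form sought takes the values [b] and [- a] on the two basis vectors; a right
   inverse [B] of [A] provides it. *)
pose z : 'cV[K]_2 := \col_i (if i == 0 then b else - a).
exists ((B *m z)^T); rewrite plE mul_minors trmxK.
have Az (i : 'I_2) : (nth 0 (vbasis (val l)) i *m (B *m z)) 0 0 = z i 0.
  have := congr1 (fun M => (M *m z) i 0) AB1; rewrite mul1mx -mulmxA => <-.
  by rewrite [RHS]mxE [LHS]mxE; apply: eq_bigr => k _; rewrite [A _ _]mxE.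
by rewrite (Az 0) (Az 1) !mxE /= scaleNr opprK addrC.
Qed.

Lemma plucker_neq0 l : exists j k, plucker l j k != 0.
Proof.
have nz_l := line_neq0 l.
have : plucker l != 0.
  apply: contraNneq nz_l => pl0; rewrite -vpick0.
  by have [w ->] := (line_plucker l _).1 (memv_pick (val l)); rewrite pl0 mulmx0.
move=> nz_pl; apply: contrapT => no; case/eqP: nz_pl.
apply/matrixP => j k; rewrite [RHS]mxE; apply/eqP; apply: contrapT => /negP ne.
by apply: no; exists j, k.
Qed.

Lemma minors_line l u v : u \in val l -> v \in val l ->
  exists c, minors u v = c *: plucker l.
Proof.
move=> /line_basisP[a [b ->]] /line_basisP[c [d ->]].
by exists (a * d - b * c); apply/matrixP => j k; rewrite !mxE; ring.
Qed.

Lemma dim_span_minors u v : minors u v != 0 -> \dim <<[:: u; v]>>%VS == 2%N.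
Proof.
move=> nz_uv; suff : free [:: u; v] by rewrite /free => /eqP ->.
rewrite free_cons span_seq1 seq1_free; apply/andP; split.
  apply: contra nz_uv => /vlineP[c ->]; apply/eqP/matrixP => j k.
  by rewrite !mxE; ring.
by apply: contra nz_uv => /eqP ->; apply/eqP/matrixP => j k; rewrite !mxE; ring.
Qed.

Lemma plucker_coordsE s (L : 'I_s -> line K) i j k :
  plucker_coords L (mxvec_index i (mxvec_index j k)) = plucker (L i) j k.
Proof. by rewrite /plucker_coords mxvecE mxE mxvecE. Qed.

End PluckerCoordinates.

Section VeryGeneral.
Variables (K : closedFieldType) (uncountableK : ~ countable [set: K]%classic).
Variable s : nat.
Implicit Types (L : 'I_s -> line K) (P Q : set ('I_s -> line K)).

Lemma very_general_sub P Q :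
  very_general P -> (forall L, P L -> Q L) -> very_general Q.
Proof. by move=> [Z [clZ ZP]] PQ; exists Z; split=> // L /ZP /PQ. Qed.

Lemma very_general_countable (P : nat -> set ('I_s -> line K)) :
  (forall n, very_general (P n)) -> very_general [set L | forall n, P n L]%classic.
Proof.
move=> /choice[Z HZ].
(* Indices that encode no pair only repeat [Z 0 0], still a proper closed set. *)
pose code n := odflt (0, 0)%N (unpickle n).
exists (fun n => Z (code n).1 (code n).2); split=> [n|L nZL n].
  by have [clZ _] := HZ (code n).1; apply: clZ.
have [_] := HZ n; apply=> -[k _ ZnkL]; apply: nZL.
by exists (pickle (n, k)) => //; rewrite /code pickleK.
Qed.

Lemma very_general_closed F : multihomogeneous F ->
  (exists L, F.@[plucker_coords L] != 0) ->
  very_general [set L : 'I_s -> line K | F.@[plucker_coords L] != 0]%classic.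
Proof.
move=> homF [L nzL].
exists (fun _ => [set L | F.@[plucker_coords L] = 0]%classic); split=> [n|L' nZ].
  split; last first.
    by move=> ZT; case/eqP: nzL; have : [set: 'I_s -> line K]%classic L by []; rewrite -ZT.
  exists [set F]%classic; first by move=> _ ->.
  by apply/predeqP => L'; split=> [FL' _ -> //|]; apply.
by apply/eqP => FL'; apply: nZ; exists 0%N.
Qed.

(* A common point of nonvanishing is found in the affine space of s-tuples of
   pairs of vectors of K^4, which dominates the product of Grassmannians. *)
Lemma very_general_nonempty P : very_general P -> exists L, P L.
Proof.
move=> [Z [clZ ZP]].
suff [L nZL] : exists L, forall n, ~ Z n L.
  by exists L; apply: ZP => -[n _]; apply: nZL.
(* A proper closed set lies in the zero set of one equation that is not identically zero. *)
have : forall n, exists F, [/\ multihomogeneous F,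
    exists L, F.@[plucker_coords L] != 0 &
    forall L, Z n L -> F.@[plucker_coords L] = 0].
  move=> n; have [[S homS defZ] ZnT] := clZ n.
  apply: contrapT => noF; apply: ZnT; rewrite defZ; apply/predeqP => L.
  split=> // _ F SF; apply/eqP; apply: contrapT => /negP nz; apply: noF.
  exists F; split; [exact: homS | by exists L | by move=> L' /=; rewrite ?defZ; apply].
move=> /choice[F HF].
suff [L nzL] : exists L, forall n, (F n).@[plucker_coords L] != 0.
  exists L => n ZnL; have [_ _ /(_ L ZnL) /eqP] := HF n.
  by rewrite (negbTE (nzL n)).
have [_ [L0 _] _] := HF 0%N.
have : forall i, exists jk, plucker (L0 i) jk.1 jk.2 != 0.
  by move=> i; have [j [k nz]] := plucker_neq0 (L0 i); exists (j, k).
move=> /choice[jk nz_jk].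
(* The additional polynomials [inr i], one Pluecker coordinate for each line, force the [i]-th pair
   of vectors to be independent. *)
pose G (t : nat + 'I_s) : {mpoly K[s * (4 * 4)]} := match t with
  | inl n => F n
  | inr i => 'X_(mxvec_index i (mxvec_index (jk i).1 (jk i).2)) end.
have G_neq0 t : exists L, (G t).@[plucker_coords L] != 0.
  case: t => [n|i]; first by have [] := HF n.
  by exists L0; rewrite mevalXU plucker_coordsE.
pose vec (x : 'I_s * bool * 'I_4 -> K) i b : 'rV[K]_4 := \row_c x (i, b, c).
pose coords x : 'I_(s * (4 * 4)) -> K :=
  mxvec (\matrix_i mxvec (minors (vec x i false) (vec x i true))) 0.
have coordsE x i j k : coords x (mxvec_index i (mxvec_index j k)) =
    x (i, false, j) * x (i, true, k) - x (i, false, k) * x (i, true, j).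
  by rewrite /coords mxvecE mxE mxvecE !mxE.
have [||x nz_x] := @countable_avoidance K uncountableK _ _
    (fun t x => (G t).@[coords x]).
- move=> t x l.
  have /choice[q Hq] : forall idx, exists q : {poly K}, forall c,
      coords (fun l' => if l' == l then c else x l') idx = q.[c].
    move=> idx; case/mxvec_indexP: idx => i jk'; case/mxvec_indexP: jk' => j k.
    pose e l' : {poly K} := if l' == l then 'X else (x l')%:P.
    exists (e (i, false, j) * e (i, true, k) - e (i, false, k) * e (i, true, j)).
    move=> c; rewrite coordsE hornerD hornerN !hornerM.
    have eE l' : (e l').[c] = if l' == l then c else x l'.
      by rewrite /e; case: ifP; rewrite ?hornerX ?hornerC.
    by rewrite !eE.
  by exists (mmap polyC q (G t)) => c; rewrite horner_mmap; apply: meval_eq.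
- move=> t; have [L nzL] := G_neq0 t.
  exists (fun l : 'I_s * bool * 'I_4 => (nth 0 (vbasis (val (L l.1.1))) l.1.2) 0 l.2).
  congr (_ != 0): nzL; apply: meval_eq => idx.
  case/mxvec_indexP: idx => i jk'; case/mxvec_indexP: jk' => j k.
  by rewrite coordsE plucker_coordsE mxE.
have nz_minors i : minors (vec x i false) (vec x i true) != 0.
  apply: contraNneq (nz_x (inr i)) => m0.
  by rewrite mevalXU /coords mxvecE mxE mxvecE m0 mxE.
pose L i : line K :=
  exist (fun U : {vspace 'rV[K]_4} => \dim U == 2%N) _ (dim_span_minors (nz_minors i)).
(* [plucker (L i)] is computed from [vbasis], not from the chosen pair; the factor [c i] between
   them is absorbed by multihomogeneity. *)
have : forall i, exists c, minors (vec x i false) (vec x i true) = c *: plucker (L i).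
  by move=> i; apply: minors_line; apply: memv_span; rewrite !inE eqxx ?orbT.
move=> /choice[c Hc]; exists L => n.
have [[d dF] _ _] := HF n.
apply: contraNneq (nz_x (inl n)) => F0.
rewrite (multidegree_meval (c := c) (x := plucker_coords L) dF) ?F0 ?mulr0 //.
move=> i k; case/mxvec_indexP: k => j k.
by rewrite plucker_coordsE /coords mxvecE mxE mxvecE Hc mxE.
Qed.

End VeryGeneral.

(** * The vanishing conditions in Pluecker coordinates *)

Section VanishingConditions.
Variables (K : fieldType) (s : nat).
Implicit Types (L : 'I_s -> line K) (w v : 'rV[K]_4).

(* Pluecker form of the restriction of the monomial [e] to the parametrized line
   [X |-> w * plucker (L l) + X v]. *)
Definition condition (l : 'I_s) w v (e : 'X_{1..4}) :
    {poly {mpoly K[s * (4 * 4)]}} :=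
  mmap1 (fun c => (\sum_a w 0 a *: 'X_(mxvec_index l (mxvec_index a c)))%:P +
                  (v 0 c)%:MP *: 'X) e.

Lemma map_condition L l w v e :
  map_poly (meval (plucker_coords L)) (condition l w v e) =
  along 'X_[e] (w *m plucker (L l)) v.
Proof.
rewrite /along mmapX /condition /mmap1 rmorph_prod; apply: eq_bigr => c _.
rewrite rmorphXn; congr (_ ^+ _); rewrite rmorphD /= map_polyZ /= map_polyX mevalC.
congr (_ + _); rewrite map_polyC /=; congr (_%:P); rewrite mxE raddf_sum.
by apply: eq_bigr => a _; rewrite /= mevalZ mevalXU plucker_coordsE.
Qed.

(** Each factor is a linear form in the coordinates of line [l] plus a constant times ['X], so the
    degree in these coordinates and the exponent of ['X] add up to [mdeg e]; [graded] records this
    property, stable under products. *)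
Lemma condition_multidegree l w v e k :
  has_multidegree (fun i => (i == l) * (mdeg e - k))%N (condition l w v e)`_k.
Proof.
pose graded D (q : {poly {mpoly K[s * (4 * 4)]}}) := forall k, if (k <= D)%N
  then has_multidegree (fun i => (i == l) * (D - k))%N q`_k else q`_k = 0.
have graded1 : graded 0%N 1.
  move=> [|j]; rewrite coef1 //= -mpolyC1.
  by apply: (@eq_multidegree _ _ (fun=> 0%N)) => [i|]; [rewrite muln0 | exact: multidegreeC].
have gradedM D1 D2 p q : graded D1 p -> graded D2 q -> graded (D1 + D2)%N (p * q).
  move=> gp gq j; rewrite coefM; case: leqP => [le_j|lt_j].
    apply: multidegree_sum => i.
    have := gp i; case: leqP => [le_i gpi|_ ->]; last by rewrite mul0r; apply: multidegree0.
    have := gq (j - i)%N; case: leqP => [le_ji gqi|_ ->].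
      apply: eq_multidegree (multidegreeM gpi gqi) => a.
      by rewrite -mulnDr; congr (_ * _)%N; have := ltn_ord i; lia.
    by rewrite mulr0; apply: multidegree0.
  rewrite big1 // => i _; have := gp i.
  case: leqP => [le_i _|_ ->]; last by rewrite mul0r.
  have := gq (j - i)%N; case: leqP => [le_ji _|_ ->]; last by rewrite mulr0.
  by have := ltn_ord i; lia.
suff /(_ k) : graded (mdeg e) (condition l w v e).
  by case: leqP => // _ ->; apply: multidegree0.
have gradedX D q n : graded D q -> graded (n * D)%N (q ^+ n).
  move=> gq; elim: n => [|n IHn]; first exact: graded1.
  by rewrite exprS mulSn; apply: (@gradedM).
rewrite mdegE /condition /mmap1; apply: (big_ind2 graded); first exact: graded1.
  by move=> *; apply: (@gradedM).
move=> c _; have -> : graded (e c) = graded (e c * 1)%N by rewrite muln1.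
apply: (@gradedX) => j.
rewrite coefD coefC coefZ coefX; case: j => [|[|j]] /=.
- rewrite mulr0 addr0; apply: multidegree_sum => a; apply: multidegreeZ.
  apply: (@eq_multidegree _ _ (fun i => (i == l) : nat)) => [i|].
    by rewrite ?subn0 muln1.
  exact: multidegreeX.
- rewrite mulr1 add0r; apply: (@eq_multidegree _ _ (fun=> 0%N)) => [i|].
    by rewrite ?subnn muln0.
  exact: multidegreeC.
by rewrite mulr0 addr0.
Qed.

Definition has_form (m t : nat) L : Prop :=
  exists F : {mpoly K[4]},
    [/\ F \is t.-homog, F != 0 & forall i, vanish_order m F (val (L i))].

End VanishingConditions.

(** The coefficients of the forms sought solve a linear system. If it has only the zero solution at
    some [L0], a maximal minor is nonzero there; this minor is multihomogeneous in the Pluecker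
    coordinates, and wherever it is nonzero there is no form. *)
Lemma has_form_dichotomy (K : closedFieldType) s m t :
  (forall L : 'I_s -> line K, has_form m t L) \/
  very_general [set L : 'I_s -> line K | ~ has_form m t L]%classic.
Proof.
have [all_form|] := pselect (forall L : 'I_s -> line K, has_form m t L).
  by left.
move=> /existsNP[L0 noL0]; right.
have [B uB [_ memB]] := homog_monomials 3 t.
(* An equation is given by a line, a vector [w] defining a point of it, a direction [v] and the
   index [k < m] of a coefficient. *)
pose W : Type := ('I_s * 'rV[K]_4 * 'rV[K]_4 * 'I_m)%type.
pose mon (e : 'I_(size B)) := nth 0%MM B e.
pose row_at (L : 'I_s -> line K) (x : W) : 'rV[K]_(size B) :=
  let: (l, w, v, k) := x in
  \row_e (along 'X_[mon e] (w *m plucker (L l)) v)`_k.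
have row_atE L F l w v (k : 'I_m) : F \is t.-homog ->
    (along F (w *m plucker (L l)) v)`_k =
    (row_at L (l, w, v, k) *m \col_e F@_(mon e)) 0 0.
  move=> homF; rewrite {1}(homog_expansion uB memB homF) /along rmorph_sum coef_sum mxE.
  apply: eq_bigr => e _; rewrite /= mmapZ coefCM !mxE mulrC; congr (_ * _).
have [x nz_x] : exists x : 'I_(size B) -> W, \det (\matrix_a row_at L0 (x a)) != 0.
  apply: full_rank_rows => c nz_c; apply: contrapT => no_row; apply: noL0.
  pose F : {mpoly K[4]} := \sum_(e < size B) c e 0 *: 'X_[mon e].
  have homF : F \is t.-homog by apply: homog_sum.
  have defc : \col_e F@_(mon e) = c.
    by apply/colP => e; rewrite mxE homog_sum_coef.
  exists F; split=> // [|i p /line_plucker[w ->] v k lt_km].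
    apply: contra_neq nz_c => F0; rewrite -defc F0.
    by apply/colP => e; rewrite !mxE mcoeff0.
  rewrite (row_atE _ _ _ _ _ (Ordinal lt_km)) // defc.
  apply/eqP; apply: contrapT => /negP nz; apply: no_row.
  exists (i, w, v, Ordinal lt_km); apply: contra_neq nz => ->.
  by rewrite mxE.
pose cond (y : W) e := let: (l, w, v, k) := y in (condition l w v (mon e))`_k.
pose A := \matrix_(a, e) cond (x a) e : 'M[{mpoly K[s * (4 * 4)]}]_(size B).
have detA L : (\det A).@[plucker_coords L] = \det (\matrix_a row_at L (x a)).
  rewrite -[LHS](det_map_mx (meval (plucker_coords L))); congr (\det _).
  apply/matrixP => a e; rewrite !mxE /cond; case: (x a) => [[[l w] v] k].
  by rewrite /row_at mxE -(coef_map (meval _)) map_condition.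
apply: (@very_general_sub _ _ [set L | (\det A).@[plucker_coords L] != 0]%classic).
  apply: very_general_closed; last by exists L0; rewrite detA.
  (* Row [a] involves only its own line, in degree [t - k] for the coefficient [k]. *)
  exists (fun i => \sum_a (i == (x a).1.1.1) * (t - (x a).2))%N.
  apply: multidegree_det => a e; rewrite mxE /cond.
  case: (x a) => [[[l w] v] k] /=.
  have -> : t = mdeg (mon e) by apply/esym/eqP; rewrite -memB mem_nth.
  exact: condition_multidegree.
move=> L /=; rewrite detA => nz_L [F [homF nz_F vF]].
case/eqP: nz_F; rewrite (homog_expansion uB memB homF) big1 // => e _.
suff F0 : \col_e F@_(mon e) = 0.
  by have /colP/(_ e) := F0; rewrite !mxE => ->; rewrite scale0r.
have unitL : \matrix_a row_at L (x a) \in unitmx by rewrite unitmxE unitfE.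
apply: (can_inj (mulKmx unitL)); rewrite mulmx0; apply/colP => a.
rewrite [RHS]mxE.
have -> : ((\matrix_a row_at L (x a)) *m \col_e F@_(mon e)) a 0 =
          (row_at L (x a) *m \col_e F@_(mon e)) 0 0.
  by rewrite !mxE; apply: eq_bigr => b _; rewrite !mxE.
case: (x a) => [[[l w] v] k]; rewrite -row_atE //.
by apply: vF => //; apply/line_plucker; exists w.
Qed.

(** * Bivariate polynomials with multiple points on the curves z = a y *)

Section BivariateEvaluation.
Variables (R A : comNzRingType) (phi : {rmorphism R -> A}) (x y : A).

Lemma comm_eval1 : commr_rmorph phi x. Proof. by move=> c; apply: mulrC. Qed.

Lemma comm_eval2 : commr_rmorph (horner_morph comm_eval1) y.
Proof. by move=> c; apply: mulrC. Qed.

(* Value at [(x, y)] of a bivariate polynomial, the outer variable being the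
   second one. *)
Definition eval2 : {poly {poly R}} -> A := horner_morph comm_eval2.

Lemma eval2M f g : eval2 (f * g) = eval2 f * eval2 g.
Proof. exact: rmorphM. Qed.

Lemma eval2E f : eval2 f =
  \sum_(j < size f) \sum_(i < size f`_j) phi f`_j`_i * x ^+ i * y ^+ j.
Proof.
rewrite -[LHS]/((map_poly (horner_morph comm_eval1) f).[y]) -[in LHS](coefK f).
rewrite poly_def rmorph_sum /= horner_sum.
apply: eq_bigr => j _; rewrite map_polyZ /= map_polyXn hornerZ hornerXn.
rewrite /horner_morph -[in LHS](coefK f`_j) poly_def rmorph_sum /= horner_sum mulr_suml.
apply: eq_bigr => i _; rewrite map_polyZ /= map_polyXn hornerZ hornerXn.
by [].
Qed.

Lemma eval2C p : eval2 p%:P = (map_poly phi p).[x].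
Proof. exact: horner_morphC. Qed.

Lemma eval2X : eval2 'X = y.
Proof. exact: horner_morphX. Qed.

Lemma eval2_monomial c i j : eval2 ((c *: 'X^i)%:P * 'X^j) = phi c * x ^+ i * y ^+ j.
Proof.
rewrite eval2M eval2C map_polyZ /= map_polyXn hornerZ hornerXn.
by rewrite /eval2 rmorphXn /= horner_morphX.
Qed.

Lemma eval2_XsubC p : eval2 ('X - p%:P) = y - (map_poly phi p).[x].
Proof. by rewrite -eval2C -[in RHS]eval2X /eval2 rmorphB. Qed.

End BivariateEvaluation.

Lemma rmorph_eval2 (R A B : comNzRingType) (phi : {rmorphism R -> A})
    (psi : {rmorphism A -> B}) (x y : A) f :
  psi (eval2 phi x y f) = eval2 (psi \o phi) (psi x) (psi y) f.
Proof.
rewrite !eval2E rmorph_sum; apply: eq_bigr => j _.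
by rewrite rmorph_sum; apply: eq_bigr => i _; rewrite !rmorphM !rmorphXn.
Qed.

Lemma eq_eval2 (R A : comNzRingType) (phi psi : {rmorphism R -> A}) (x y : A) f :
  phi =1 psi -> eval2 phi x y f = eval2 psi x y f.
Proof.
move=> eq_phi; rewrite !eval2E; apply: eq_bigr => j _.
by apply: eq_bigr => i _; rewrite eq_phi.
Qed.

Section PointMultiplicity.
Variable K : fieldType.
Implicit Types (f g : {poly {poly K}}) (p : {poly K}) (l mu a w : K).

(* Pull back of [f] to the chart [(X, v) |-> (l + X, mu + v X)] of the blow-up
   of the plane at [(l, mu)]; the result is a polynomial in [X] over [K[v]]. *)
Definition blow_up l mu f : {poly {poly K}} :=
  eval2 (polyC \o polyC) (l%:P%:P + 'X) (mu%:P%:P + 'X%:P * 'X) f.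

(** [X = 0] is the exceptional curve, along which the pull back vanishes to the order of
    multiplicity of [f] at the point. *)
Definition point_order m l mu f : Prop := low_coefs0 m (blow_up l mu f).

(** [da] bounds the degree in the inner variable y, [db] the degree in the outer variable z. *)
Definition bidegree_le (da db : nat) f : bool :=
  (size (swapXY f) <= da.+1)%N && (size f <= db.+1)%N.

Lemma map_blow_up l mu w f :
  map_poly (horner_eval w) (blow_up l mu f) =
  eval2 polyC (l%:P + 'X) (mu%:P + w%:P * 'X) f.
Proof.
rewrite /blow_up rmorph_eval2 /=.
rewrite !(rmorphD, rmorphM) /= !map_polyX !map_polyC /= /horner_eval !hornerE.
by apply: eq_eval2 => c /=; rewrite map_polyC /= /horner_eval hornerC.
Qed.

Lemma eval2_curve a l f :
  eval2 polyC (l%:P + 'X) ((a * l)%:P + a%:P * 'X) f = f.[a *: 'X] \Po ('X + l%:P).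
Proof.
have -> : f.[a *: 'X] = eval2 polyC 'X (a *: 'X) f.
  rewrite eval2E horner_coef; apply: eq_bigr => j _; rewrite -mulr_suml.
  by congr (_ * _); rewrite -[LHS]coefK poly_def; apply: eq_bigr => i _; rewrite mul_polyC.
rewrite -[RHS]/(comp_poly ('X + l%:P) _) rmorph_eval2 /= comp_polyX comp_polyZ comp_polyX.
rewrite scalerDr -mul_polyC -mul_polyC -polyCM [a%:P * _ + _]addrC [_ + l%:P]addrC.
by apply: eq_eval2 => c /=; rewrite comp_polyC.
Qed.

(** The curve z = a y is the line of slope [a] through the point, that is [v = a] in the chart of
    the blow-up. *)
Lemma point_order_curve m l a f :
  point_order m l (a * l) f -> ('X - l%:P) ^+ m %| f.[a *: 'X].
Proof.
move=> f0; have /low_coefs0P[q] : low_coefs0 m (f.[a *: 'X] \Po ('X + l%:P)).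
  move=> k lt_km; rewrite -eval2_curve -(map_blow_up _ _ a) coef_map /=.
  by rewrite f0 // raddf0.
move=> /(congr1 (comp_poly ('X - l%:P))).
rewrite -comp_polyA comp_polyD comp_polyX comp_polyC subrK comp_polyXr => ->.
by rewrite rmorphM rmorphXn /= comp_polyX dvdp_mull.
Qed.

Lemma size_horner_curve da db a f :
  bidegree_le da db f -> (size f.[a *: 'X] <= (da + db).+1)%N.
Proof.
move=> /andP[]; rewrite -sizeYE => le_da le_db; rewrite horner_coef.
apply: (leq_trans (size_sum _ _ _)); apply/bigmax_leqP => j _.
apply: (leq_trans (size_polyMleq _ _)).
have szX : (size ((a *: 'X : {poly K}) ^+ j) <= j.+1)%N.
  by rewrite exprZn (leq_trans (size_scale_leq _ _)) // size_polyXn.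
have le_fj : (size (f`_j)%R <= da.+1)%N := leq_trans (max_size_coefXY f j) le_da.
have le_j : (j.+1 <= db.+1)%N := leq_trans (ltn_ord j) le_db.
rewrite -[(da + db).+1]/((da.+1 + db).+1.-1) -addnS -!subn1 leq_sub2r //.
by rewrite leq_add // (leq_trans szX).
Qed.

Lemma prod_XsubC_exp_dvd m (r : seq K) p : uniq r ->
  (forall x, x \in r -> ('X - x%:P) ^+ m %| p) ->
  (\prod_(x <- r) ('X - x%:P)) ^+ m %| p.
Proof.
elim: r => [|x r IHr] /=; first by rewrite big_nil expr1n dvd1p.
case/andP=> nxr ur dvd_p; rewrite big_cons exprMn Gauss_dvdp.
  rewrite dvd_p ?mem_head // IHr // => y yr; apply: dvd_p.
  by rewrite in_cons yr orbT.
rewrite coprimep_expl // coprimep_expr // coprimep_sym.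
by rewrite coprimep_XsubC root_prod_XsubC.
Qed.

(** Bezout argument: the restriction to the curve has degree at most [da + db] but [size r * m]
    roots with multiplicity. *)
Lemma curve_eq0 m (r : seq K) da db a f : uniq r -> bidegree_le da db f ->
  (da + db < size r * m)%N ->
  (forall l, l \in r -> point_order m l (a * l) f) -> f.[a *: 'X] = 0.
Proof.
move=> ur deg_f lt_deg ord_f; apply/eqP; apply: contraT => nz.
have := prod_XsubC_exp_dvd ur (fun l lr => point_order_curve (ord_f l lr)).
move=> /(dvdp_leq nz) le_sz.
have := leq_trans le_sz (size_horner_curve a deg_f).
have := size_exp (\prod_(x <- r) ('X - x%:P)) m.
rewrite size_prod_XsubC /= => szP; move: lt_deg; rewrite -szP.
by case: (size _) => // n; rewrite ltnS /= => lt_n; rewrite leqNgt lt_n.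
Qed.

(** The pull back of z - a y is [(mu - a l) + (v - a) X]. Off the curve its constant term is nonzero
    and the order is kept; on the curve it is [X] times a nonzero constant term, and one order is
    lost. *)
Lemma point_order_divide m l mu a f :
  point_order m l mu (f * ('X - (a *: 'X)%:P)) ->
  point_order (if mu == a * l then m.-1 else m) l mu f.
Proof.
rewrite /point_order /blow_up eval2M eval2_XsubC.
rewrite map_polyZ /= map_polyX hornerZ hornerX mulrC.
set u := _ - _; set g := eval2 _ _ _ _.
have uE : u = (mu - a * l)%:P%:P + ('X - a%:P)%:P * 'X.
  by rewrite /u !(polyCB, polyCM); ring.
case: eqP => [mu_al|/eqP ne_mu]; last first.
  apply: low_coefs0_cancel; rewrite uE coefD coefC coefMX /= addr0.
  by rewrite polyC_eq0 subr_eq0.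
case: m => [|m] //; rewrite uE mu_al subrr !polyC0 add0r mulrAC -mulrC mulrC.
rewrite [_ * 'X]mulrC => /low_coefs0_mulX.
by apply: low_coefs0_cancel; rewrite coefC /= polyXsubC_eq0.
Qed.

Lemma curve_divide da db a f : a != 0 -> f != 0 -> bidegree_le da db f ->
  f.[a *: 'X] = 0 ->
  exists g, [/\ f = g * ('X - (a *: 'X)%:P), g != 0, (0 < da)%N, (0 < db)%N &
                bidegree_le da.-1 db.-1 g].
Proof.
move=> nz_a nz_f deg_f /eqP/factor_theorem[g def_f]; exists g.
have nz_g : g != 0 by apply: contraNneq nz_f => g0; rewrite def_f g0 mul0r.
have sz_h : size (swapXY ('X - (a *: 'X)%:P) : {poly {poly K}}) = 2%N.
  rewrite rmorphB /= swapXY_X swapXY_polyC map_polyZ map_polyX /= -opprB size_polyN.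
  rewrite size_polyDl size_scale ?polyC_eq0 ?size_polyX //.
  by rewrite size_polyN size_polyC; case: (_ != 0).
have nz_h : swapXY ('X - (a *: 'X)%:P) != 0 :> {poly {poly K}}.
  by rewrite -size_poly_gt0 sz_h.
have nz_sg : swapXY g != 0 by rewrite swapXY_eq0.
move: deg_f; rewrite /bidegree_le def_f rmorphM /= size_mul // sz_h.
have sz_f : size ('X - (a *: 'X)%:P : {poly {poly K}}) = 2%N by apply: size_XsubC.
rewrite size_mul ?polyXsubC_eq0 // sz_f.
move: nz_g nz_sg; rewrite -!size_poly_gt0.
case: (size (swapXY g)) => // n1; case: (size g) => // n2 _ _.
by rewrite !addn2 /= !ltnS => /andP[lt_da lt_db]; split; move: lt_da lt_db => //; lia.
Qed.

End PointMultiplicity.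

(** * Forms vanishing on transversals of two skew lines *)

Section CurveReduction.
Variables (K : fieldType) (q s : nat) (a : 'I_q -> K) (tau : 'I_s -> 'I_q).
Variable l : 'I_s -> K.
Hypotheses (a_inj : injective a) (a_neq0 : forall i, a i != 0).
Hypotheses (l_inj : injective l) (l_neq0 : forall c, l c != 0).
Local Notation points i := #|[pred c | tau c == i]|.

(* Whenever the degrees of [f] are too small, the curve [z = a i * y] splits off
   from [f]; the multiplicities that remain when this stops are [m']. *)
Lemma curve_reduction (m : 'I_q -> nat) da db (f : {poly {poly K}}) :
  f != 0 -> bidegree_le da db f ->
  (forall c, point_order (m (tau c)) (l c) (a (tau c) * l c) f) ->
  exists (m' : 'I_q -> nat) d', [/\ forall i, (m' i <= m i)%N,
    forall i, (points i * m' i <= d')%N &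
    (da + db + 2 * \sum_i m' i = d' + 2 * \sum_i m i)%N].
Proof.
(* Induction on the total multiplicity; each splitting preserves the difference between the total
   degree and twice this sum. *)
have [N le_mN] := ubnP (\sum_i m i); elim: N => // N IHN in m da db f le_mN *.
move=> nz_f deg_f ord_f.
case: (boolP [forall i, points i * m i <= da + db]%N) => [/forallP le_d|].
  by exists m, (da + db)%N; split.
rewrite negb_forall => /existsP[i]; rewrite -ltnNge => lt_d.
have mi_gt0 : (0 < m i)%N by case: (m i) lt_d => //; rewrite muln0.
have fi0 : f.[a i *: 'X] = 0.
  apply: (@curve_eq0 _ (m i) [seq l c | c <- enum [pred c | tau c == i]] da db) => //.
  - by rewrite map_inj_uniq ?enum_uniq.
  - by rewrite size_map -cardE.
  move=> x /mapP[c]; rewrite mem_enum inE => /eqP tc ->.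
  by have := ord_f c; rewrite tc.
have [g [def_f nz_g da_gt0 db_gt0 deg_g]] := curve_divide (a_neq0 i) nz_f deg_f fi0.
pose m1 j := if j == i then (m i).-1 else m j.
have sum_m1 : (\sum_j m j = (\sum_j m1 j).+1)%N.
  rewrite (bigD1 i) //= [in RHS](bigD1 i) //= {1}/m1 eqxx -addSn prednK //.
  by congr (_ + _)%N; apply: eq_bigr => j /negbTE ne; rewrite /m1 ne.
(* As [a] is injective and [l c] is nonzero, the curve passes only through the points [c] with
   [tau c = i]. *)
have ord_g c : point_order (m1 (tau c)) (l c) (a (tau c) * l c) g.
  have := ord_f c; rewrite def_f => /point_order_divide.
  rewrite (inj_eq (mulIf (l_neq0 c))) (inj_eq a_inj) /m1.
  by case: eqP => [->|].
have le_m1N : (\sum_j m1 j < N)%N by move: le_mN; rewrite sum_m1.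
have [m' [d' [le_m' le_d' sum_d']]] := IHN m1 _ _ g le_m1N nz_g deg_g ord_g.
exists m', d'; split=> // [j|].
  by apply: leq_trans (le_m' j) _; rewrite /m1; case: eqP => // ->; apply: leq_pred.
by rewrite sum_m1; lia.
Qed.

End CurveReduction.

Section SpecialLines.
Variables (K : fieldType) (charK0 : [pchar K] =i pred0).

Definition vec4 (x y z t : K) : 'rV[K]_4 := \row_i nth 0 [:: x; y; z; t] i.

Lemma transversal_minors (x y : K) : minors (vec4 1 0 x 0) (vec4 0 1 0 y) != 0.
Proof.
apply/eqP => /matrixP/(_ (inord 0) (inord 1)); rewrite !mxE !inordK //= => /eqP.
by rewrite mulr1 mulr0 subr0 oner_eq0.
Qed.

(* The line joining the points [(1, 0, x, 0)] and [(0, 1, 0, y)]; all of these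
   lines meet the lines [x1 = x3 = 0] and [x0 = x2 = 0]. *)
Definition transversal_line (x y : K) : line K :=
  exist (fun U : {vspace 'rV[K]_4} => \dim U == 2%N) _
    (dim_span_minors (transversal_minors x y)).

Lemma transversal_mem (x y t : K) : vec4 1 t x (t * y) \in val (transversal_line x y).
Proof.
have -> : vec4 1 t x (t * y) = vec4 1 0 x 0 + t *: vec4 0 1 0 y.
  by apply/rowP => -[[|[|[|[|//]]]] lt_i]; rewrite !mxE /=; ring.
by rewrite memvD ?memvZ ?memv_span ?inE ?eqxx ?orbT.
Qed.

Let e0 : 'I_4 := @Ordinal 4 0 isT.
Let e1 : 'I_4 := @Ordinal 4 1 isT.
Let e2 : 'I_4 := @Ordinal 4 2 isT.
Let e3 : 'I_4 := @Ordinal 4 3 isT.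

Lemma big_ord4 (R : Type) (idx : R) (op : Monoid.law idx) (F : 'I_4 -> R) :
  \big[op/idx]_i F i = op (F e0) (op (F e1) (op (F e2) (F e3))).
Proof.
rewrite !big_ord_recl big_ord0 Monoid.mulm1.
by congr (op (F _) (op (F _) (op (F _) (F _)))); apply: val_inj.
Qed.

(* The part of [F] of degree [b] in the variables x1 and x3, with x0 = x1 = 1. *)
Definition component (F : {mpoly K[4]}) (b : nat) : {poly {poly K}} :=
  \sum_(e <- msupp F | (e e1 + e e3 == b)%N) (F@_e *: 'X^(e e2))%:P * 'X^(e e3).

Lemma coef_component F b i j :
  (component F b)`_j`_i = \sum_(e <- msupp F | (e e1 + e e3 == b)%N &&
     ((e e2 == i) && (e e3 == j))) F@_e.
Proof.
rewrite /component !coef_sum big_mkcondr /=; apply: eq_bigr => e _.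
rewrite coefCM coefXn; case: (eqVneq (e e3) j) => _ /=; last first.
  by rewrite andbF mulr0 coef0.
by rewrite mulr1 coefZ coefXn andbT eq_sym; case: eqP; rewrite ?mulr1 ?mulr0.
Qed.

(** The exponents of x1 and x3 add up to [b], hence those of x0 and x2 to [t - b]. *)
Lemma component_bidegree F t b : F \is t.-homog -> (b <= t)%N ->
  bidegree_le (t - b) b (component F b).
Proof.
move=> homF le_bt.
have comp0 i j : (t - b < i)%N || (b < j)%N -> (component F b)`_j`_i = 0.
  move=> out; rewrite coef_component big_seq_cond big1 // => e /and3P[eF /eqP eb].
  case/andP=> /eqP ei /eqP ej; have /eqP := dhomog_mf homF eF.
  by rewrite /= mdegE big_ord4 /= => /eqP; lia.
apply/andP; split; apply/leq_sizeP => j lt_j.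
  by apply/polyP => i; rewrite coef_swapXY comp0 ?lt_j // coef0.
by apply/polyP => i; rewrite comp0 ?lt_j ?orbT // coef0.
Qed.

(** Once [t] and [b] are fixed, the exponents of x2 and x3 determine those of x0 and x1, so setting
    x0 = x1 = 1 cancels no monomials; [b] is taken from the leading monomial. *)
Lemma component_neq0 F t : F \is t.-homog -> F != 0 ->
  exists2 b, (b <= t)%N & component F b != 0.
Proof.
move=> homF nz_F; have eF := mlead_supp nz_F; set e := mlead F in eF.
have deg e' : e' \in msupp F -> (e' e0 + (e' e1 + (e' e2 + e' e3)) = t)%N.
  by move=> e'F; have := dhomog_mf homF e'F; rewrite /= mdegE big_ord4.
exists (e e1 + e e3)%N; first by have := deg e eF; lia.
apply/eqP => /(congr1 (fun f : {poly {poly K}} => f`_(e e3)`_(e e2))).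
rewrite !coef0 coef_component big_mkcond (bigD1_seq e) ?msupp_uniq //= !eqxx /=.
rewrite big_seq_cond big1 ?addr0 => [|e' /andP[e'F ne_e']].
  by apply/eqP; rewrite -mcoeff_msupp.
case: ifP => // /andP[/eqP eb /andP[/eqP e2E /eqP e3E]].
case/eqP: ne_e'; apply/mnmP.
have d := deg e eF; have d' := deg e' e'F.
have e1E : e' e1 = e e1 by lia.
have e0E : e' e0 = e e0 by lia.
move=> [[|[|[|[|//]]]] lt_i].
- by have -> : Ordinal lt_i = e0 by apply: val_inj.
- by have -> : Ordinal lt_i = e1 by apply: val_inj.
- by have -> : Ordinal lt_i = e2 by apply: val_inj.
by have -> : Ordinal lt_i = e3 by apply: val_inj.
Qed.

(** At the point of parameter [z] of the line, in the direction [(0, 0, 1, z w)], the restriction of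
    [F] is the sum over [c] of [z ^+ c] times the restriction of the component [c] to slope [w].
    Since [z] is arbitrary, each component vanishes separately to order [m]. *)
Lemma component_point_order m F t b (x y : K) : F \is t.-homog -> (b <= t)%N ->
  vanish_order m F (val (transversal_line x y)) -> point_order m x y (component F b).
Proof.
move=> homF le_bt ordF k lt_km.
apply: (poly_fun_eq0 charK0) => w.
rewrite -[_.[w]]/(horner_eval w _) -(coef_map (horner_eval w)) map_blow_up.
pose value c := eval2 polyC (x%:P + 'X) (y%:P + w%:P * 'X) (component F c).
have alongE z : along F (vec4 1 z x (z * y)) (vec4 0 0 1 (z * w)) =
    \sum_(c < t.+1) (z ^+ c)%:P * value c.
  have valueE c : value c = \sum_(e <- msupp F | (e e1 + e e3 == c)%N)
      (F@_e)%:P * (x%:P + 'X) ^+ e e2 * (y%:P + w%:P * 'X) ^+ e e3.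
    rewrite /value /component /eval2 rmorph_sum; apply: eq_bigr => e _.
    exact: eval2_monomial.
  rewrite /along /mmap.
  transitivity (\sum_(e <- msupp F) \sum_(c < t.+1 | (e e1 + e e3 == c)%N)
      (z ^+ c)%:P * ((F@_e)%:P * (x%:P + 'X) ^+ e e2 * (y%:P + w%:P * 'X) ^+ e e3)).
    apply: eq_big_seq => e eF; have := dhomog_mf homF eF.
    rewrite /= mdegE big_ord4 /= => deg.
    have lt_c : (e e1 + e e3 < t.+1)%N by lia.
    rewrite (big_pred1 (Ordinal lt_c)) => [|c]; last by rewrite eq_sym.
    have vecE (a1 a2 a3 a4 : K) : [/\ vec4 a1 a2 a3 a4 0 e0 = a1,
        vec4 a1 a2 a3 a4 0 e1 = a2, vec4 a1 a2 a3 a4 0 e2 = a3 &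
        vec4 a1 a2 a3 a4 0 e3 = a4] by rewrite !mxE.
    rewrite /mmap1 big_ord4 /=.
    have [-> -> -> ->] := vecE 1 z x (z * y).
    have [-> -> -> ->] := vecE 0 0 1 (z * w).
    rewrite !scale0r !addr0 polyC1 expr1n mul1r scale1r.
    rewrite -mul_polyC !polyCM -mulrA -mulrDr exprMn exprD polyCM !polyC_exp; ring.
  rewrite (exchange_big_dep xpredT) //=; apply: eq_bigr => c _.
  by rewrite valueE mulr_sumr.
(* The coefficient of [X ^ k], as a polynomial in [z]. *)
have H : \poly_(c < t.+1) (value c)`_k = 0.
  apply: (poly_fun_eq0 charK0) => z; rewrite horner_poly.
  have := ordF _ (transversal_mem x y z) (vec4 0 0 1 (z * w)) k lt_km.
  rewrite alongE coef_sum => sum0; rewrite -[RHS]sum0; apply: eq_bigr => c _.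
  by rewrite coefCM mulrC.
have := congr1 (fun p : {poly K} => p`_b) H.
by rewrite coef_poly ltnS le_bt coef0.
Qed.

End SpecialLines.

(** * The special configuration and its degree bounds *)

Section SpecialConfiguration.
Variables (K : fieldType) (charK0 : [pchar K] =i pred0) (s q : nat).
Hypothesis q_gt0 : (0 < q)%N.

Definition residue (c : 'I_s) : 'I_q := Ordinal (ltn_pmod c q_gt0).

(* The quadrics [x0 x3 = a x1 x2], for [a] = 1, ..., q, contain the lines of the
   configuration, distributed cyclically. *)
Definition special_lines (c : 'I_s) : line K :=
  transversal_line c.+1%:R ((residue c).+1%:R * c.+1%:R).

Lemma special_lines_reduction m t : has_form m t special_lines ->
  exists (m' : 'I_q -> nat) d', [/\ forall i, (m' i <= m)%N,
    forall i, (#|[pred c | residue c == i]| * m' i <= d')%N &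
    (t + 2 * \sum_i m' i = d' + 2 * (q * m))%N].
Proof.
move=> [F [homF nz_F ordF]].
have [b le_bt nz_f] := component_neq0 homF nz_F.
have natS_neq0 n : n.+1%:R != 0 :> K by rewrite (iffLR (pcharf0P K) charK0).
have natS_inj n : injective (fun i : 'I_n => i.+1%:R : K).
  by move=> i j /(natr_inj_char0 charK0) [] /val_inj.
have [||||c|m' [d' [le_m' le_d' eq_d]]] := @curve_reduction _ _ _
    (fun i : 'I_q => i.+1%:R : K) residue (fun c => c.+1%:R) _ _ _ _
    (fun=> m) _ _ _ nz_f (component_bidegree homF le_bt) => //.
  exact: (component_point_order charK0 homF le_bt (ordF c)).
exists m', d'; split=> //; move: eq_d.
by rewrite subnK // sum_nat_const card_ord.
Qed.

(** The indices [i + q * r] for [r] from 0 to [j] all have residue [i]. *)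
Lemma residue_card (i : 'I_q) j : (i + q * j < s)%N ->
  (j < #|[pred c | residue c == i]|)%N.
Proof.
move=> lt_s; have lt_r (r : 'I_j.+1) : (i + q * r < s)%N.
  by apply: leq_ltn_trans lt_s; rewrite leq_add2l leq_mul2l -ltnS ltn_ord orbT.
pose f r := Ordinal (lt_r r).
have f_inj : injective f.
  move=> r1 r2 /(congr1 val) /= /addnI /eqP.
  by rewrite eqn_pmul2l // => /eqP /val_inj.
rewrite -[j.+1]card_ord -(fintype.card_image f_inj).
apply/subset_leq_card/fintype.subsetP => c.
move=> /fintype.imageP[r _ ->]; rewrite inE; apply/eqP/val_inj => /=.
by rewrite addnC mulnC modnMDl modn_small.
Qed.

(** Let [x] be the largest remaining multiplicity. A curve where it occurs has at least [j] points,
    so [d' >= j x], while at most [q x] of the total multiplicity remains: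
    [t >= j x + 2 q (m - x) >= j m]. *)
Lemma special_lines_uniform m t j : (j <= 2 * q)%N -> (j * q <= s)%N ->
  has_form m t special_lines -> (j * m <= t)%N.
Proof.
move=> le_j le_s /special_lines_reduction[m' [d' [le_m' le_d' eq_t]]].
pose x := \max_i m' i.
have le_sum : (\sum_i m' i <= q * x)%N.
  rewrite -[q in (q * x)%N]card_ord -sum_nat_const; apply: leq_sum => i _.
  exact: leq_bigmax.
have le_x : (x <= m)%N by apply/bigmax_leqP.
have le_jx : (j * x <= d')%N.
  have [|i0 def_x] := @bigop.eq_bigmax _ m'; first by rewrite card_ord.
  rewrite /x def_x.
  apply: leq_trans (le_d' i0); rewrite leq_mul2r; apply/orP; right.
  case: j le_s {le_j} => // j le_s; apply: residue_card.
  by apply: leq_trans le_s; rewrite mulSn mulnC ltn_add2r ltn_ord.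
have : (j * (m - x) <= 2 * q * (m - x))%N by rewrite leq_mul2r le_j orbT.
rewrite !mulnBr => le1; have le2 : (j * x <= j * m)%N by rewrite leq_mul2l le_x orbT.
have le3 : (2 * q * x <= 2 * q * m)%N by rewrite leq_mul2l le_x orbT.
by lia.
Qed.

End SpecialConfiguration.

Lemma special_lines5 (K : fieldType) (charK0 : [pchar K] =i pred0) m t :
  has_form m t (@special_lines K 5 2 isT) -> (8 * m <= 3 * t)%N.
Proof.
move=> /(special_lines_reduction charK0)[m' [d' [le_m' le_d' eq_t]]].
have h0 := @residue_card 5 2 isT ord0 2 isT.
have h1 := @residue_card 5 2 isT ord_max 1 isT.
have le0 : (3 * m' ord0 <= d')%N.
  by apply: leq_trans (le_d' ord0); rewrite leq_mul2r h0 orbT.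
have le1 : (2 * m' ord_max <= d')%N.
  by apply: leq_trans (le_d' ord_max); rewrite leq_mul2r h1 orbT.
move: eq_t; rewrite big_ord_recr big_ord1 /=.
have -> : widen_ord (leqnSn 1) ord0 = ord0 by apply: val_inj.
(* Twice [le0] plus [le1], together with [m' ord_max <= m]. *)
by have := le_m' ord0; have := le_m' ord_max; lia.
Qed.

(** To be applied with [k] = T + 1. The number of quadrics is [k / 4] rounded up, and [j] is [2 q]
    or [2 q - 1]. *)
Lemma vanishing_bound (K : fieldType) (charK0 : [pchar K] =i pred0) s k :
  (0 < s)%N -> (k * k.+1 <= 6 * s)%N ->
  exists L : 'I_s -> line K, forall m t, has_form m t L -> (k * m <= 2 * t)%N.
Proof.
move=> s_gt0 le_k.
have [[-> ->]|[q [j [q_gt0 le_kj le_jq le_jqs]]]] : (s = 5 /\ k = 5)%N \/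
    exists q j, [/\ 0 < q, k <= 2 * j, j <= 2 * q & j * q <= s]%N.
- case: (eqVneq k 0%N) => [->|k_neq0].
    by right; exists 1%N, 0%N.
  pose q := ((k + 3) %/ 4)%N; have [r lt_r4 def_k] : exists2 r, (r < 4)%N & (k + r = 4 * q)%N.
    exists (3 - (k + 3) %% 4)%N; first by lia.
    by rewrite /q; lia.
  have q_gt0 : (0 < q)%N by lia.
  have -> : k = (4 * q - r)%N by lia.
  move: le_k; have -> : k = (4 * q - r)%N by lia.
  case: r lt_r4 {def_k} => [|[|[|[|//]]]] _ le_k.
  + by right; exists q, (2 * q)%N; split; nia.
  + by right; exists q, (2 * q)%N; split; nia.
  + by right; exists q, (2 * q - 1)%N; split; nia.
  (* For [k = 4 q - 3] the hypothesis gives [q (2 q - 1) <= s] at once if [q >= 3]; for [q = 2],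
     that is [k = 5], six lines are needed, and five lines are the exception. *)
  case: (ltngtP q 2) => [lt_q2|gt_q2|q2].
  + by right; exists 1%N, 1%N; split; nia.
  + by right; exists q, (2 * q - 1)%N; split; nia.
  rewrite q2 in le_k *; case: (ltngtP s 5) => [||->]; [lia| |by left].
  by right; exists 2%N, 3%N; split; lia.
- exists (@special_lines K 5 2 isT) => m t /(special_lines5 charK0); lia.
exists (special_lines K q_gt0) => m t /(special_lines_uniform charK0 le_jq le_jqs).
by move=> le_t; apply: leq_trans (leq_mul le_kj (leqnn m)) _; rewrite -mulnA leq_mul2l.
Qed.

(** * Forms through arbitrary lines *)

Section Counting.
Variables (K : fieldType) (charK0 : [pchar K] =i pred0).

Lemma size_along_monomial n (e : 'X_{1..n}) (p v : 'rV[K]_n) :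
  (size (along 'X_[e] p v) <= (mdeg e).+1)%N.
Proof.
rewrite /along mmapX /mmap1 mdegE.
apply: (big_ind2 (fun (f : {poly K}) d => (size f <= d.+1)%N)).
- by rewrite size_poly1.
- move=> f d g d' le_f le_g; apply: leq_trans (size_polyMleq _ _) _.
  by rewrite -[(d + d').+1]/((d.+1 + d').+1.-1) -addnS -!subn1 leq_sub2r ?leq_add.
move=> c _; apply: leq_trans (size_poly_exp_leq _ _) _.
have : (size ((p 0 c)%:P + v 0 c *: 'X)%R <= 2)%N.
  apply: leq_trans (size_polyD _ _) _; rewrite geq_max.
  rewrite (leq_trans (size_polyC_leq1 _)) // (leq_trans (size_scale_leq _ _)) //.
  by rewrite size_polyX.
move=> le2; rewrite ltnS -{2}[e c]mul1n leq_mul2r; apply/orP; right.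
by case: (size _) le2 => [|[|[]]].
Qed.

Lemma size_along_homog n t (F : {mpoly K[n]}) (p v : 'rV[K]_n) :
  F \is t.-homog -> (size (along F p v) <= t.+1)%N.
Proof.
move=> homF; rewrite [F]mpolyE /along raddf_sum /= big_seq.
apply: (leq_trans (size_sum _ _ _)); apply/bigmax_leqP_seq => e eF _.
rewrite mmapZ mul_polyC (leq_trans (size_scale_leq _ _)) //.
by rewrite -(dhomog_mf homF eF); apply: size_along_monomial.
Qed.

Lemma meval_homog n t (F : {mpoly K[n]}) (x : K) (v : 'rV[K]_n) :
  F \is t.-homog -> F.@[(x *: v) 0] = x ^+ t * F.@[v 0].
Proof.
move=> homF; rewrite !mevalE mulr_sumr; apply: eq_big_seq => e eF.
rewrite mulrCA -(dhomog_mf homF eF) /= mdegE -prodrXr -big_split.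
by congr (_ * _); apply: eq_bigr => i _; rewrite mxE exprMn.
Qed.

(** By homogeneity, vanishing on the affine line [u + X v] gives vanishing at all combinations with
    nonzero coefficient of [u]. The combination [p] is moved along [u], and the factor ['X + a%:P]
    covers the one excluded parameter. *)
Lemma along_eq0_line n t (F : {mpoly K[n]}) (u v : 'rV[K]_n) a b :
  F \is t.-homog -> along F u v = 0 -> F.@[(a *: u + b *: v) 0] = 0.
Proof.
move=> homF Fuv0; set p := _ + _.
have : ('X + a%:P) * along F p u = 0.
  apply: (poly_fun_eq0 charK0) => x; rewrite hornerM horner_along hornerD hornerX hornerC.
  case: (eqVneq (x + a) 0) => [->|nz]; first by rewrite mul0r.
  have -> : p + x *: u = (x + a) *: (u + (b / (x + a)) *: v).
    by rewrite /p scalerDr scalerA mulrCA divff // mulr1 addrAC -scalerDl [a + x]addrC.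
  by rewrite (meval_homog _ _ homF) -horner_along Fuv0 horner0 !mulr0.
move/eqP; rewrite mulf_eq0 => /orP[|/eqP F0].
  by rewrite -[a%:P]opprK -polyCN polyXsubC_eq0.
by rewrite -(along_coef0 F p u) F0 coef0.
Qed.

(** A form of degree [t] has [t + 1] coefficients on each line, which makes [s * (t + 1)] linear
    conditions on ['C(t + 3, t)] unknowns. *)
Lemma form_exists s t (L : 'I_s -> line K) : (s * t.+1 < 'C(t + 3, t))%N ->
  has_form 1 t L.
Proof.
move=> lt_C; have [B uB [szB memB]] := homog_monomials 3 t.
pose u i := (vbasis (val (L i)))`_0; pose v i := (vbasis (val (L i)))`_1.
pose M := \matrix_(e < size B)
  mxvec (\matrix_(i < s, k < t.+1) (along 'X_[nth 0%MM B e] (u i) (v i))`_k).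
have nz_ker : kermx M != 0.
  rewrite kermx_eq0 /row_free; apply: contraTneq lt_C => rankM.
  by rewrite -leqNgt -szB -rankM rank_leq_col.
have [r nz_r] : exists r, row r (kermx M) != 0.
  apply/existsP; apply: contraR nz_ker; rewrite negb_exists => /forallP r0.
  by apply/eqP/row_matrixP => r; rewrite row0; apply/eqP; rewrite -[_ == _]negbK.
set c := row r (kermx M) in nz_r.
have cM0 : c *m M = 0 by apply/sub_kermxP; apply: row_sub.
pose F : {mpoly K[4]} := \sum_(e < size B) c 0 e *: 'X_[nth 0%MM B e].
have homF : F \is t.-homog by apply: homog_sum.
have F0 i : along F (u i) (v i) = 0.
  apply/polyP => k; rewrite coef0; case: (ltnP k t.+1) => [lt_k | le_k]; last first.
    by rewrite nth_default // (leq_trans (size_along_homog _ _ homF)).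
  transitivity ((c *m M) 0 (mxvec_index i (Ordinal lt_k))); last by rewrite cM0 mxE.
  rewrite [RHS]mxE /F /along rmorph_sum coef_sum.
  apply: eq_bigr => e _.
  by rewrite /= mmapZ coefCM [M _ _]mxE mxvecE mxE.
exists F; split=> // [|i p /line_basisP[a [b ->]] w [|//] _].
  apply: contra_neq nz_r => Fz; apply/rowP => e.
  by rewrite -(homog_sum_coef (fun e => c 0 e)) // -/F Fz mcoeff0 mxE.
by rewrite along_coef0; apply: along_eq0_line homF (F0 i).
Qed.

Lemma form_exists_bound s t (L : 'I_s -> line K) :
  (6 * s < t.+2 * t.+3)%N -> has_form 1 t L.
Proof.
move=> lt_6s; apply: form_exists.
have := bin_ffact (t + 3) 3; rewrite !ffactnS ffactn0 addn3 /= muln1.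
have -> : 'C(t.+3, 3) = 'C(t.+3, t) by rewrite -bin_sub ?leq_addl // -addn3 ?addnK.
rewrite (_ : 3`! = 6)%N // => E; nia.
Qed.

End Counting.

(** * Fekete's lemma *)

Section Fekete.
Variables (R : realType) (u : nat -> nat).
Hypothesis u_subadd : forall m n, (u (m + n) <= u m + u n)%N.

Lemma subadditive_mul k n r : (u (k * n + r) <= k * u n + u r)%N.
Proof.
elim: k => [|k IHk] //; rewrite !mulSn -!addnA.
by apply: leq_trans (u_subadd _ _) _; rewrite leq_add2l.
Qed.

(** Fekete: the quotients converge to their infimum over [m > 0], which is at least [c]. *)
Lemma subadditive_lim_ge (c : R) :
  (forall m, c * m%:R <= (u m)%:R) ->
  c <= limn (fun m => (u m)%:R / m%:R : R)%classic.
Proof.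
move=> le_c.
pose S : set R := [set x | exists2 m, (0 < m)%N & x = (u m)%:R / m%:R]%classic.
have S_lb x : S x -> c <= x.
  by move=> [m m_gt0 ->]; rewrite ler_pdivlMr ?ltr0n.
have infS : has_inf S.
  by split; [exists ((u 1)%:R / 1%:R), 1%N | exists c => x /S_lb].
set l := inf S.
have le_cl : c <= l by apply: lb_le_inf; [exact: infS.1 | move=> x /S_lb].
suff cvg_u : ((fun m => (u m)%:R / m%:R : R) @ \oo --> l)%classic.
  by rewrite (cvg_lim _ cvg_u) //; apply: Rhausdorff.
apply/cvg_ballP => e e_gt0.
have e2_gt0 : 0 < e / 2 by rewrite divr_gt0.
have [x [n n_gt0 ->] lt_x] := inf_adherent e2_gt0 infS.
(* [C] bounds the contribution of the remainder of [m] modulo [n], negligible after division by a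
   large [m]. *)
pose C := \max_(r < n) u r.
have bound_ge0 : 0 <= C%:R / (e / 2) :> R by rewrite divr_ge0 // ltW.
exists (Num.bound (C%:R / (e / 2) : R)).+1 => // m /= lt_m.
have m_gt0 : (0 < m)%N by apply: leq_ltn_trans lt_m.
have lt_Cm : C%:R / m%:R < e / 2 :> R.
  rewrite ltr_pdivrMr ?ltr0n // -ltr_pdivrMl // mulrC.
  by apply: lt_trans (archi_boundP bound_ge0) _; rewrite ltr_nat.
have le_um : (u m)%:R / m%:R <= (u n)%:R / n%:R + C%:R / m%:R :> R.
  have le_u : (u m <= m %/ n * u n + C)%N.
    rewrite {1}(divn_eq m n); apply: leq_trans (subadditive_mul _ _ _) _.
    rewrite leq_add2l; exact: (leq_bigmax (Ordinal (ltn_pmod m n_gt0))).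
  rewrite -(ler_pM2r (_ : 0 < m%:R :> R)) ?ltr0n // mulrDl !divfK ?pnatr_eq0 -?lt0n //.
  apply: le_trans (_ : (m %/ n * u n + C)%:R <= _); first by rewrite ler_nat.
  rewrite natrD lerD2r natrM [leRHS]mulrAC -mulrA [leRHS]mulrC ler_wpM2r //.
  by rewrite ler_pdivlMr ?ltr0n // -natrM ler_nat leq_divM.
have le_l : l <= (u m)%:R / m%:R by apply: ge_inf; [exact: infS.2 | exists m].
rewrite /ball /= distrC ger0_norm ?subr_ge0 // ltrBlDl.
by apply: le_lt_trans le_um _; rewrite [e]splitr addrA ltrD.
Qed.

End Fekete.

(** * The Waldschmidt constant of very general lines *)

Lemma initial_degreeP (K : fieldType) n (I : set {mpoly K[n]}) :
  (exists t, exists2 f, graded_part I t f & f != 0) ->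
  (exists2 f, graded_part I (initial_degree I) f & f != 0) /\
  forall t, (exists2 f, graded_part I t f & f != 0) -> (initial_degree I <= t)%N.
Proof.
move=> exI; rewrite /initial_degree; set P := (X in xget _ X).
suff exP : exists t, P t by have := xgetPex 0%N exP.
have exI' : exists t, `[< exists2 f, graded_part I t f & f != 0 >].
  by have [t It] := exI; exists t; apply: asboolT.
exists (ex_minn exI'); case: ex_minnP => t /asboolP It min_t.
by split=> // t' It'; exact/min_t/asboolT.
Qed.

(** The zero set of the constant 1 is empty, and it is proper since lines exist. *)
Lemma very_generalT (K : closedFieldType) s :
  very_general [set: 'I_s -> line K]%classic.
Proof.
have homog1 : multihomogeneous (1 : {mpoly K[s * (4 * 4)]}).
  by exists (fun=> 0%N); rewrite -mpolyC1; apply: multidegreeC.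
apply: very_general_sub (very_general_closed homog1 _) _ => //.
by exists (fun=> transversal_line 0 0); rewrite meval1 oner_neq0.
Qed.

Section WaldschmidtOfLines.
Variables (K : closedFieldType) (charK0 : [pchar K] =i pred0).
Variable s : nat.
Implicit Types (L : 'I_s -> line K) (m n t : nat).

Local Notation degree m L := (initial_degree (symbolic_power (lines_ideal L) m)).

Lemma graded_part_symbolic m t L :
  (exists2 F, graded_part (symbolic_power (lines_ideal L) m) t F & F != 0) <->
  has_form m t L.
Proof.
split=> [[F [symF homF] nz_F] | [F [homF nz_F ordF]]]; exists F => //.
  by split=> //; apply/(symbolic_powerP charK0).
by split=> //; apply/(symbolic_powerP charK0).
Qed.

Lemma has_formM m n t t' L :
  has_form m t L -> has_form n t' L -> has_form (m + n) (t + t') L.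
Proof.
move=> [F [homF nz_F ordF]] [G [homG nz_G ordG]]; exists (F * G); split.
- exact: dhomogM.
- by rewrite mulf_neq0.
by move=> i; apply: vanish_orderM.
Qed.

Lemma has_formX m t L : has_form 1 t L -> has_form m (t * m) L.
Proof.
move=> [F [homF nz_F ordF]]; exists (F ^+ m); split.
- exact: dhomogMn.
- by rewrite expf_neq0.
move=> i p Lp v; rewrite /along rmorphXn.
exact/low_coefs0X/(ordF i p Lp v).
Qed.

Lemma has_form_exists L m : exists t, has_form m t L.
Proof.
exists (6 * s * m)%N; apply/has_formX/form_exists_bound => //; nia.
Qed.

Lemma degreeP m L :
  has_form m (degree m L) L /\ forall t, has_form m t L -> (degree m L <= t)%N.
Proof.
have [t Lt] := has_form_exists L m.
have [|formL minL] := @initial_degreeP _ _ (symbolic_power (lines_ideal L) m).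
  by exists t; apply/graded_part_symbolic.
split; first exact/graded_part_symbolic.
by move=> t' /graded_part_symbolic /minL.
Qed.

Lemma lines_ideal_initial_degree t L :
  has_form 1 t L -> (initial_degree (lines_ideal L) <= t)%N.
Proof.
move=> [F [homF nz_F ordF]].
have IF : exists2 f, graded_part (lines_ideal L) t f & f != 0.
  exists F => //; split=> // i v Lv _.
  by rewrite -(along_coef0 F v 0) (ordF i v Lv).
by have [_] := initial_degreeP (ex_intro _ t IF); apply.
Qed.

(** [n] is the least degree in which all [L] have a form. In each smaller degree the dichotomy
    leaves only the very general absence of forms. *)
Lemma very_general_degree m : exists n, (forall L, has_form m n L) /\
  very_general [set L : 'I_s -> line K | degree m L = n]%classic.
Proof.
have ex_n : exists n, `[< forall L : 'I_s -> line K, has_form m n L >].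
  exists (6 * s * m)%N; apply: asboolT => L.
  by apply/has_formX/form_exists_bound => //; nia.
case: (ex_minnP ex_n) => n /asboolP all_n min_n; exists n; split=> //.
apply: (@very_general_sub _ _
    [set L | forall t, (t < n)%N -> ~ has_form m t L]%classic); last first.
  move=> L no_form; have [formL minL] := degreeP m L; apply/eqP.
  rewrite eqn_leq minL // leqNgt; apply/negP => lt_n.
  exact: no_form lt_n formL.
apply: very_general_countable => t.
case: (has_form_dichotomy K s m t) => [all_t | vg].
  apply: very_general_sub (very_generalT K s) _ => L _.
  by rewrite ltnNge min_n //; apply: asboolT.
by apply: very_general_sub vg _ => L noL _.
Qed.

Lemma very_general_degrees : exists n : nat -> nat,
  (forall m L, has_form m (n m) L) /\
  very_general [set L : 'I_s -> line K | forall m, degree m L = n m]%classic.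
Proof.
have /choice[n Hn] := very_general_degree.
exists n; split=> [m L|]; first by have [] := Hn m.
by apply: very_general_countable => m; have [] := Hn m.
Qed.

Lemma degree_subadditive L m n : (degree (m + n) L <= degree m L + degree n L)%N.
Proof.
have [Lm _] := degreeP m L; have [Ln _] := degreeP n L.
by have [_ ->] := degreeP (m + n) L; last exact: has_formM.
Qed.

Lemma waldschmidt_ge (R : realType) (c : R) L :
  (forall m, c * m%:R <= (degree m L)%:R) -> c <= waldschmidt R (lines_ideal L).
Proof. by move=> le_c; apply: subadditive_lim_ge => // m n; apply: degree_subadditive. Qed.

End WaldschmidtOfLines.

Lemma alpha_le (K : closedFieldType) (charK0 : [pchar K] =i pred0)
    (uncountableK : ~ countable [set: K]%classic) s t :
  (6 * s < t.+2 * t.+3)%N -> (alpha K s <= t)%N.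
Proof.
(* The default value 0 of [xget] satisfies the bound trivially. *)
move=> lt_6s; rewrite /alpha /very_general_value; case: xgetP => // x -> vg.
have [L <-] := very_general_nonempty uncountableK vg.
exact/(lines_ideal_initial_degree)/(form_exists_bound charK0).
Qed.

Lemma alpha_hat_ge (K : closedFieldType) (charK0 : [pchar K] =i pred0)
    (uncountableK : ~ countable [set: K]%classic) (R : realType) s k :
  (0 < s)%N -> (k * k.+1 <= 6 * s)%N -> k%:R / 2%:R <= alpha_hat K R s.
Proof.
move=> s_gt0 le_k.
have [n [form_n vg_n]] := very_general_degrees charK0 s.
pose P : set R := [set x | very_general
  [set L : 'I_s -> line K | waldschmidt R (lines_ideal L) = x]]%classic.
have exP : exists x, P x.
  exists (limn (fun m => (n m)%:R / m%:R : R))%classic.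
  apply: very_general_sub vg_n _ => L degL; congr (limn _)%classic.
  by apply: funext => m; rewrite degL.
have vg_w : P (alpha_hat K R s) := xgetPex 0 exP.
have [L [degL wL]] : exists L : 'I_s -> line K,
    (forall m, initial_degree (symbolic_power (lines_ideal L) m) = n m) /\
    waldschmidt R (lines_ideal L) = alpha_hat K R s.
  (* Both properties hold very generally, hence at a common [L]. *)
  pose Q (i : nat) : set ('I_s -> line K) := if i == 0%N
    then [set L | forall m, initial_degree (symbolic_power (lines_ideal L) m) = n m]%classic
    else [set L | waldschmidt R (lines_ideal L) = alpha_hat K R s]%classic.
  have vg_Q i : very_general (Q i) by case: i.
  have [L QL] := very_general_nonempty uncountableK (very_general_countable vg_Q).
  by exists L; split; [exact: (QL 0%N) | exact: (QL 1%N)].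
rewrite -wL; apply: (waldschmidt_ge charK0) => m.
(* The very general degree [n m] is attained by a form on every configuration, in particular on the
   special one [L0], where it can be bounded. *)
have [L0 bound] := vanishing_bound charK0 s_gt0 le_k.
have := bound m (n m) (form_n m L0); rewrite degL => le_km.
by rewrite mulrAC ler_pdivrMr ?ltr0n // -!natrM ler_nat [(n m * 2)%N]mulnC.
Qed.

Theorem theorem5 (K : closedFieldType) (charK0 : [pchar K] =i pred0)
    (uncountableK : ~ countable [set: K]%classic)
    (R : realType) (s : nat) (s_gt0 : (1 <= s)%N) :
  alpha_hat K R s >= ((alpha K s)%:R + 1) / 2%:R.
Proof.
have ex_t : exists t, (6 * s < t.+2 * t.+3)%N by exists (6 * s)%N; nia.
case: (ex_minnP ex_t) => t lt_6s min_t.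
(* Minimality of [t]; this is the condition of [alpha_hat_ge] for [k = t.+1]. *)
have le_6s : (t.+1 * t.+2 <= 6 * s)%N.
  case: t lt_6s min_t => [|t] _ min_t; first by lia.
  by rewrite leqNgt; apply/negP => /min_t; rewrite ltnn.
apply: le_trans (alpha_hat_ge charK0 uncountableK R s_gt0 le_6s).
rewrite ler_pM2r ?invr_gt0 ?ltr0n // -natr1 lerD2r ler_nat.
exact: alpha_le.
Qed.
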